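(* For every pair of Banach spaces $Y$ and $Z$ the inequality $$20\, d_{\Omega}(Y,Z)\ \ge\ k(Y,Z)$$ is valid.
   Context: For a Banach space $X$, $S(X)$ denotes its unit sphere and $X^*$ its dual. Spherical opening. For closed subspaces $Y,Z$ of a Banach space $X$, let $$\Omega_0(Y,Z)=\sup\{\mathrm{dist}(y,S(Z)):\ y\in S(Y)\},\qquad \Omega(Y,Z)=\max\{\Omega_0(Y,Z),\Omega_0(Z,Y)\}.$$ The quantity $d_\Omega$. For Banach spaces $Y,Z$ let $$d_{\Omega}(Y,Z)=\inf_{X,U,V}\Omega(UY,VZ),$$ where the infimum is taken over all Banach spaces $X$ containing isometric copies of $Y$ and $Z$ and over all (linear) isometric embeddings $U:Y\to X$ and $V:Z\to X$. The quantity $k$. For Banach spaces $Y,Z$, $k(Y,Z)$ is the infimum of the quantities $$\sup\{|y^*(y)-(Dy^* )(Ty)|:\ y\in S(Y),\ y^*\in S(Y^* )\}$$ taken over all surjective mappings $T:S(Y)\to S(Z)$ and $D:S(Y^* )\to S(Z^* )$ (arbitrary surjective maps of sets, no continuity or linearity is required). If such mappings (at least one of $T$, $D$) do not exist, then $k(Y,Z)=2$. *)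

(* Defs.v *)
From HB Require Import structures.
From mathcomp Require Import all_boot all_order all_algebra.
From mathcomp Require Import complex.
From mathcomp Require Import all_classical all_reals all_analysis.
Set Implicit Arguments.
Unset Strict Implicit.
Unset Printing Implicit Defensive.
Import Order.TTheory GRing.Theory Num.Theory.
Import numFieldNormedType.Exports.
Local Open Scope classical_set_scope.
Local Open Scope ring_scope.
Local Open Scope ereal_scope.

(* A Banach space is a completeNormedModType over R or over R[i].  All
   suprema and infima are taken in \bar R, where ereal_sup set0 = -oo and
   ereal_inf set0 = +oo; such a supremum or infimum over the empty set only
   occurs for the zero space, whose unit sphere is empty. *)

Variant scalars := RealScalars | ComplexScalars.

Definition scalar_field (R : realType) (s : scalars) : numFieldType :=
  match s with
  | RealScalars => R
  | ComplexScalars => complex R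
  end.

Definition scalar_re (R : realType) (s : scalars) : scalar_field R s -> R :=
  match s with
  | RealScalars => fun x => x
  | ComplexScalars => fun x => complex.Re x
  end.

Section banach.
Context {R : realType} {s : scalars}.
Local Notation K := (scalar_field R s).

(* The norm of a normedModType over K takes its values in K, among the
   nonnegative real elements, hence scalar_re loses no information. *)
Definition enorm {X : normedModType K} (x : X) : \bar R :=
  (scalar_re `|x|%R)%:E.

Definition unit_sphere {X : normedModType K} (A : set X) : set X :=
  [set x | A x /\ `|x|%R = 1%R].

Definition dist {X : normedModType K} (x : X) (A : set X) : \bar R :=
  ereal_inf [set enorm (x - a)%R | a in A].

Definition Omega0 {X : normedModType K} (A B : set X) : \bar R :=
  ereal_sup [set dist y (unit_sphere B) | y in unit_sphere A].

Definition Omega {X : normedModType K} (A B : set X) : \bar R :=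
  maxe (Omega0 A B) (Omega0 B A).

Definition isometric {Y X : normedModType K} (U : Y -> X) : Prop :=
  forall y, `|U y|%R = `|y|%R.

Definition d_Omega (Y Z : completeNormedModType K) : \bar R :=
  ereal_inf [set r | exists (X : completeNormedModType K)
    (U : {linear Y -> X}) (V : {linear Z -> X}),
    [/\ isometric U, isometric V & r = Omega (range U) (range V)]].

Definition dual_norm {Y : normedModType K} (f : Y -> K^o) : \bar R :=
  ereal_sup [set enorm (f y) | y in [set y : Y | `|y|%R <= 1]%R].

Definition dual_sphere (Y : normedModType K) : set (Y -> K^o) :=
  [set f | [/\ linear f, continuous f & dual_norm f = 1]].
Arguments dual_sphere : clear implicits.

(* T and D are total functions, of which only the restrictions to the unit
   spheres matter. *)
Definition k_gap {Y Z : normedModType K} (T : Y -> Z)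
    (D : (Y -> K^o) -> (Z -> K^o)) : \bar R :=
  ereal_sup [set enorm (f y - D f (T y))%R
            | y in unit_sphere [set: Y] & f in dual_sphere Y].

Definition k_values (Y Z : normedModType K) : set (\bar R) :=
  [set r | exists (T : {surjfun unit_sphere [set: Y] >-> unit_sphere [set: Z]})
    (D : {surjfun dual_sphere Y >-> dual_sphere Z}), r = k_gap T D].

(* k_values Y Z is empty exactly when T or D cannot be found. *)
Definition k (Y Z : normedModType K) : \bar R :=
  if k_values Y Z == set0 then 2%:E else ereal_inf (k_values Y Z).

End banach.

(* Main.v *)
(* When the opening of U Y and V Z is less than w, each unit vector z has a unit
   vector phi z with |U (phi z) - V z| <= w; on the duals one extends functionals
   from V Z to X (Hahn-Banach) and restricts them to U Y.  Such a phi separates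
   points that are not too close to each other, but it need not be injective,
   whereas a surjection S(Y) -> S(Z) that displaces points little is obtained
   from an injection S(Z) -> S(Y) close to phi.  To correct phi, take a net P of
   S(Z), on which phi is injective, and send a point z near n in P to the
   normalization of phi n + r h(z), where r is tiny and h is an injection of Z
   into a real hyperplane W = ker f of Y, phi n having been moved off W.
   Normalization is then injective because f recovers the norm.  The injection
   h exists for reasons of cardinality: Z embeds into the sequences in R x P,
   hence into the sequences in a net M of S(W), and sequences in M are summed
   into W by completeness.  If W = 0 then Y is a real line, and phi itself is
   injective.  The losses add up to 12 w. *)
Require Import Defs.
From HB Require Import structures.
From mathcomp Require Import all_boot all_order all_algebra.
From mathcomp Require Import complex.
From mathcomp Require Import all_classical all_reals all_analysis.
From mathcomp Require Import ring lra.
Set Implicit Arguments.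
Unset Strict Implicit.
Unset Printing Implicit Defensive.
Import Order.TTheory GRing.Theory Num.Theory.
Import numFieldNormedType.Exports.
Local Open Scope classical_set_scope.
Local Open Scope ring_scope.

(** * The reals inside the scalar field *)

Section scalars.
Context {R : realType} {s : scalars}.
Local Notation K := (scalar_field R s).

Definition of_real : R -> K :=
  match s with RealScalars => id | ComplexScalars => real_complex R end.

Lemma of_real_is_zmod_morphism : zmod_morphism of_real.
Proof.
rewrite /of_real; case: s => //= x y.
by rewrite -rmorphB.
Qed.

Lemma of_real_is_monoid_morphism : monoid_morphism of_real.
Proof.
rewrite /of_real; case: s => //=.
by split=> [|x y]; rewrite ?rmorph1 ?rmorphM.
Qed.

HB.instance Definition _ :=
  GRing.isZmodMorphism.Build R K of_real of_real_is_zmod_morphism.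
HB.instance Definition _ :=
  GRing.isMonoidMorphism.Build R K of_real of_real_is_monoid_morphism.

Local Notation re := (@scalar_re R s).

Lemma scalar_re_is_zmod_morphism : zmod_morphism re.
Proof. by rewrite /scalar_re; case: s => //= -[a b] [c d]. Qed.

HB.instance Definition _ :=
  GRing.isZmodMorphism.Build K R re scalar_re_is_zmod_morphism.

Lemma scalar_reK : cancel of_real re.
Proof. by rewrite /scalar_re /of_real; case: s. Qed.

Lemma scalar_reM r x : re (of_real r * x) = r * re x.
Proof.
rewrite /scalar_re /of_real; move: x; case: s => //= -[a b] /=.
by rewrite mul0r subr0.
Qed.

Lemma ge0_scalar_re (x : K) : 0 <= x -> of_real (re x) = x.
Proof.
rewrite /scalar_re /of_real; move: x; case: s => //= x x0.
exact/RRe_real/ger0_real.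
Qed.

Lemma ler_of_real (a b : R) : (of_real a <= of_real b) = (a <= b).
Proof. by rewrite /of_real; case: s => //=; rewrite lecR. Qed.

Lemma ltr_of_real (a b : R) : (of_real a < of_real b) = (a < b).
Proof. by rewrite /of_real; case: s => //=; rewrite ltcR. Qed.

Lemma normr_of_real (a : R) : `|of_real a| = of_real `|a|.
Proof.
rewrite /of_real; case: s => //=.
by rewrite normc_def /= expr0n addr0 sqrtr_sqr.
Qed.

End scalars.
Arguments of_real {R} s _.

(** * Real-valued norms *)

Section real_norm.
Context {R : realType} {s : scalars}.
Local Notation K := (scalar_field R s).
Local Notation re := (@scalar_re R s).
Import ComplexField.
Local Open Scope complex_scope.
Local Notation "r %:K" := (of_real s r) (at level 2, format "r %:K").

Definition rnorm {X : normedModType K} (x : X) : R := re `|x|.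

Lemma rnormE {X : normedModType K} (x : X) : `|x| = (rnorm x)%:K.
Proof. by rewrite /rnorm ge0_scalar_re. Qed.

Lemma enormE {X : normedModType K} (x : X) : enorm x = (rnorm x)%:E.
Proof. by []. Qed.

Lemma rnormZ {X : normedModType K} (c : K) (x : X) :
  rnorm (c *: x) = rnorm (c : K^o) * rnorm x.
Proof. by rewrite /rnorm normrZ (rnormE (c : K^o)) scalar_reM scalar_reK. Qed.

Lemma rnorm_of_real r : rnorm (r%:K : K^o) = `|r|.
Proof. by rewrite /rnorm normr_of_real scalar_reK. Qed.

Lemma rnorm_ge0 {X : normedModType K} (x : X) : 0 <= rnorm x.
Proof. by rewrite -(@ler_of_real R s) -rnormE rmorph0. Qed.

Lemma rnormD {X : normedModType K} (x y : X) :
  rnorm (x + y) <= rnorm x + rnorm y.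
Proof.
by have := ler_normD x y; rewrite !rnormE -rmorphD ler_of_real.
Qed.

Lemma rnorm0_eq0 {X : normedModType K} (x : X) : rnorm x = 0 -> x = 0.
Proof. by move=> x0; apply/normr0_eq0; rewrite rnormE x0 rmorph0. Qed.

Lemma rnorm_eq1 {X : normedModType K} (x : X) : (`|x| = 1) <-> rnorm x = 1.
Proof.
rewrite rnormE -(rmorph1 (of_real s)); split=> [|->//].
exact/(can_inj scalar_reK).
Qed.

Lemma ler_abs_re (z : K) : `|re z| <= rnorm (z : K^o).
Proof.
have -> : rnorm (z : K^o) = re `|z| by [].
rewrite /scalar_re; move: z; case: s => [z|[a b]] /=; first exact: lexx.
by have := normc_ge_Re (a +i* b); rewrite normc_def lecR.
Qed.

End real_norm.

(** * The Hahn-Banach theorem for real functionals *)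

Section hahn_banach.
Context {R : realType} {s : scalars}.
Local Notation K := (scalar_field R s).
Local Notation "r %:K" := (of_real s r) (at level 2, format "r %:K").

Definition real_linear {X : lmodType K} (f : X -> R) :=
  forall r x y, f (r%:K *: x + y) = r * f x + f y.

Lemma real_linear0 (X : lmodType K) (f : X -> R) : real_linear f -> f 0 = 0.
Proof.
move=> fl; have := fl 1 0 0; rewrite rmorph1 scale1r addr0 mul1r => h.
by apply: (addrI (f 0)); rewrite addr0.
Qed.

Lemma real_linearZ (X : lmodType K) (f : X -> R) : real_linear f ->
  forall r x, f (r%:K *: x) = r * f x.
Proof. by move=> fl r x; have := fl r x 0; rewrite (real_linear0 fl) !addr0. Qed.

Lemma real_linearD (X : lmodType K) (f : X -> R) : real_linear f ->
  forall x y, f (x + y) = f x + f y.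
Proof. by move=> fl x y; have := fl 1 x y; rewrite rmorph1 scale1r mul1r. Qed.

Lemma real_linearN (X : lmodType K) (f : X -> R) : real_linear f ->
  forall x, f (- x) = - f x.
Proof.
by move=> fl x; have := real_linearZ fl (-1) x; rewrite rmorphN1 scaleN1r mulN1r.
Qed.

Lemma real_linearB (X : lmodType K) (f : X -> R) : real_linear f ->
  forall x y, f (x - y) = f x - f y.
Proof. by move=> fl x y; rewrite (real_linearD fl) (real_linearN fl). Qed.

Variables (X : lmodType K) (p : X -> R).
Hypothesis pD : forall x y, p (x + y) <= p x + p y.
Hypothesis pZ : forall r x, p (r%:K *: x) = `|r| * p x.

(** Functionals on real subspaces are represented by their graphs, so that extension is inclusion
    and a chain of extensions is bounded by its union. *)
Definition linear_graph (A : set (X * R)) :=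
  forall r u v, A u -> A v -> A (r%:K *: u.1 + v.1, r * u.2 + v.2).

Definition dominated_graph (A : set (X * R)) := forall u, A u -> u.2 <= p u.1.

Let p0 : p 0 = 0.
Proof. by have := pZ 0 0; rewrite scaler0 normr0 mul0r. Qed.

Lemma linear_graphZ (A : set (X * R)) : linear_graph A -> A (0, 0) ->
  forall r u, A u -> A (r%:K *: u.1, r * u.2).
Proof. by move=> Al A0 r u Au; have := Al r u _ Au A0; rewrite /= !addr0. Qed.

(** Two values at one point differ by a value of the graph at 0, which is at most [p 0 = 0]. *)
Lemma dominated_graph_functional (A : set (X * R)) :
  linear_graph A -> dominated_graph A ->
  forall x a b, A (x, a) -> A (x, b) -> a = b.
Proof.
move=> Al Ad.
have le x a b : A (x, a) -> A (x, b) -> b <= a.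
  move=> Aa Ab; have /Ad /= := Al (-1) _ _ Aa Ab.
  by rewrite rmorphN1 scaleN1r addNr p0 mulN1r addrC subr_le0.
by move=> x a b Aa Ab; apply/eqP; rewrite eq_le (le x b a)// (le x a b).
Qed.

(** The value [c] at [x0] has to lie above every [u.2 - p (u.1 - x0)] and below every
    [p (v.1 + x0) - v.2]. Subadditivity of [p] puts the former below the latter, so the supremum of
    the former will do. *)
Lemma dominated_graph_extend (A : set (X * R)) (x0 : X) :
  linear_graph A -> dominated_graph A -> A (0, 0) ->
  exists B, [/\ linear_graph B, dominated_graph B, A `<=` B &
    exists c, B (x0, c)].
Proof.
move=> Al Ad A0.
pose S := [set u.2 - p (u.1 - x0) | u in A].
have cross u v : A u -> A v -> u.2 - p (u.1 - x0) <= p (v.1 + x0) - v.2.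
  move=> Au Av; have /Ad /= := Al 1 u v Au Av.
  rewrite rmorph1 scale1r mul1r.
  have := pD (u.1 - x0) (v.1 + x0).
  have -> : u.1 - x0 + (v.1 + x0) = u.1 + v.1 by rewrite addrACA addNr addr0.
  by lra.
have hsS : has_sup S.
  split; first by exists (0 - p (0 - x0)), (0, 0).
  exists (p (0 + x0) - 0) => _ [u Au <-]; exact: (cross u (0, 0)).
pose c := sup S.
have lec u : A u -> u.2 - p (u.1 - x0) <= c.
  by move=> Au; apply: sup_upper_bound => //; exists u.
have gec v : A v -> c <= p (v.1 + x0) - v.2.
  move=> Av; apply: sup_le_ub; first by case: hsS.
  by move=> _ [u Au <-]; exact: cross.
exists [set w | exists t u, A u /\ w = (t%:K *: x0 + u.1, t * c + u.2)]; split.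
- move=> r _ _ [t [u [Au ->]]] [t' [u' [Au' ->]]] /=.
  exists (r * t + t'), (r%:K *: u.1 + u'.1, r * u.2 + u'.2); split; first exact: Al.
  congr pair => /=; last by ring.
  by rewrite scalerDr scalerA addrACA -scalerDl rmorphD rmorphM.
- move=> _ [t [u [Au ->]]] /=.
  (* After division by the absolute value of [t], the case [t < 0] is a lower bound on [c] and the
     case [t > 0] an upper bound. *)
  have [t0|t0|->] := ltgtP t 0.
  + have tN0 : 0 < - t by rewrite oppr_gt0.
    have E : - t * p ((- t)^-1%:K *: u.1 - x0) = p (t%:K *: x0 + u.1).
      rewrite -{1}(gtr0_norm tN0) -pZ scalerBr scalerA -rmorphM/= mulfV ?gt_eqF//.
      by rewrite rmorph1 scale1r rmorphN scaleNr opprK addrC.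
    have := lec _ (linear_graphZ Al A0 (- t)^-1 Au) => /=.
    rewrite -(ler_pM2l tN0) mulrBr mulrA mulfV ?gt_eqF// mul1r E; lra.
  + have E : t * p (t^-1%:K *: u.1 + x0) = p (t%:K *: x0 + u.1).
      rewrite -{1}(gtr0_norm t0) -pZ scalerDr scalerA -rmorphM/= mulfV ?gt_eqF//.
      by rewrite rmorph1 scale1r addrC.
    have := gec _ (linear_graphZ Al A0 t^-1 Au) => /=.
    rewrite -(ler_pM2l t0) mulrBr mulrA mulfV ?gt_eqF// mul1r E; lra.
  + by rewrite rmorph0 scale0r mul0r !add0r; exact: Ad.
- move=> u Au; exists 0, u; split=> //.
  by rewrite rmorph0 scale0r mul0r !add0r; case: u {Au}.
- by exists c, 1, (0, 0); split=> //; rewrite rmorph1 scale1r mul1r !addr0.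
Qed.

Lemma hahn_banach_real (G : set (X * R)) :
  G (0, 0) -> linear_graph G -> dominated_graph G ->
  exists f : X -> R, [/\ real_linear f, forall x, f x <= p x &
    forall u, G u -> f u.1 = u.2].
Proof.
move=> G0 Gl Gd.
(* Zorn's lemma also asks that the union of the empty chain be good; containing [G] is therefore
   required of nonempty sets only. A maximal set is nonempty because [G] itself is good. *)
pose good A := [/\ linear_graph A, dominated_graph A & A !=set0 -> G `<=` A].
have [F Fgood Ftot|A [[Al Ad GA] Amax]] := @Zorn_bigcup _ good.
  split.
  - move=> r u v [B FB Bu] [C FC Cv].
    by have [BC|CB] := Ftot _ _ FB FC; [exists C|exists B] => //;
      [have [+ _ _] := Fgood _ FC|have [+ _ _] := Fgood _ FB]; apply; auto.
  - by move=> u [B FB Bu]; have [_ Bd _] := Fgood _ FB; exact: Bd.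
  - move=> [u [B FB Bu]] v Gv; exists B => //.
    by have [_ _ GB] := Fgood _ FB; apply: GB => //; exists u.
have A0 : A (0, 0).
  have [A0|/set0P/GA] := eqVneq A set0; last by apply.
  exfalso; apply: (Amax G); last by split=> // _ u.
  by rewrite A0; split; [exact: sub0set|move=> /(_ _ G0)].
have {}GA : G `<=` A by apply: GA; exists (0, 0).
have /choice[f fA] x : exists a, A (x, a).
  apply: contrapT => xA.
  have [B [Bl Bd AB [c Bc]]] := dominated_graph_extend x Al Ad A0.
  apply: (Amax B); first by split=> // /(_ _ Bc) Ac; apply: xA; exists c.
  by split=> // _ u /GA /AB.
have fE x a : A (x, a) -> f x = a.
  by move=> Axa; exact: dominated_graph_functional Al Ad _ _ _ (fA x) Axa.
exists f; split.
- by move=> r x y; apply: fE; exact: (Al r (x, f x) (y, f y)).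
- by move=> x; exact: (Ad _ (fA x)).
- by move=> [x a] /GA; exact: fE.
Qed.

End hahn_banach.

(** * Passing between real and complex functionals *)

Section complexification.
Import ComplexField.
Local Open Scope complex_scope.
Context {R : realType} {s : scalars}.
Local Notation K := (scalar_field R s).
Local Notation re := (@scalar_re R s).
Local Notation "r %:K" := (of_real s r) (at level 2, format "r %:K").

Lemma linear_fun0 (X : lmodType K) (f : X -> K^o) : linear f -> f 0 = 0.
Proof. by move=> fl; have := fl (-1) 0 0; rewrite scaler0 addr0 scaleN1r addNr. Qed.

Lemma linear_funZ (X : lmodType K) (f : X -> K^o) : linear f ->
  forall c x, f (c *: x) = c *: f x.
Proof. by move=> fl c x; have := fl c x 0; rewrite !addr0 (linear_fun0 fl) addr0. Qed.

Lemma linear_funB (X : lmodType K) (f : X -> K^o) : linear f ->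
  forall x y, f (x - y) = f x - f y.
Proof. by move=> fl x y; rewrite addrC -scaleN1r fl scaleN1r addrC. Qed.

(** In the complex case the imaginary part of [f x] is minus the real part of [f (i x)]. *)
Lemma linear_ext_re (X : lmodType K) (f g : X -> K^o) :
  linear f -> linear g -> (forall x, re (f x) = re (g x)) -> f =1 g.
Proof.
rewrite /scalar_re; move: X f g; case: s => [X f g _ _ fg x|X f g fl gl fg x].
  exact: fg.
have scal (h : X -> R[i]^o) : linear h -> forall c y, h (c *: y) = (c : R[i]) * h y.
  move=> hl c y.
  have h0 : h 0 = 0 by have := hl (-1) 0 0; rewrite scaler0 addr0 scaleN1r addNr.
  by have := hl c y 0; rewrite !addr0 h0 addr0.
apply/eqP; rewrite eq_complex fg eqxx /=; apply/eqP.
have := fg ('i%C *: x); rewrite (scal _ fl) (scal _ gl).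
by case: (f x) (g x) => [a b] [c d] /=; rewrite !mul0r !mul1r !sub0r => /oppr_inj.
Qed.

Lemma unimodular_re (z : K) :
  exists c : K, rnorm (c : K^o) = 1 /\ re (c * z) = rnorm (z : K^o).
Proof.
have [->|z0] := eqVneq z 0.
  exists 1; rewrite mulr0 raddf0 /rnorm normr0 normr1 raddf0; split=> //.
  by rewrite -(rmorph1 (of_real s)) scalar_reK.
exists (`|z| / z); split.
  apply/rnorm_eq1; rewrite (_ : `|_ : K^o| = `| `|z| / z|)//.
  by rewrite normrM normfV normr_id mulfV// normr_eq0.
by rewrite mulfVK.
Qed.

Lemma real_linear_scalar_re (X : normedModType K) (F : X -> R) :
  real_linear F -> (forall x, F x <= rnorm x) ->
  exists f : X -> K^o, [/\ linear f, forall x, re (f x) = F x &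
    forall x, rnorm (f x) <= rnorm x].
Proof.
move=> Fl Fle.
have [f fl fF] : exists2 f : X -> K^o, linear f & forall x, re (f x) = F x.
  move: X F Fl {Fle}; rewrite /scalar_re /of_real /real_linear /of_real.
  case: s => X F Fl.
    by exists F => // a u v; exact: Fl.
  have FZ := real_linearZ (Fl : real_linear (s := ComplexScalars) F).
  have FD := real_linearD (Fl : real_linear (s := ComplexScalars) F).
  have FN := real_linearN (Fl : real_linear (s := ComplexScalars) F).
  (* A complex functional with real part [F] must be [F x - i F (i x)]. *)
  exists (fun x => Complex (F x) (- F ('i%C *: x))) => //.
  move=> [a b] u v.
  have E w : (Complex a b) *: w = (of_real ComplexScalars a) *: w +
      (of_real ComplexScalars b) *: ('i%C *: w) :> X.
    rewrite scalerA -scalerDl; congr (_ *: _); rewrite /of_real /=.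
    by apply/eqP; rewrite eq_complex/= !mulr0 !mul0r !mulr1 subr0 !add0r !addr0 !eqxx.
  rewrite scalerDr scalerA [('i%C * _)]mulrC -scalerA !E !FD !FZ.
  rewrite scalerA (_ : ('i%C : R[i]) * 'i%C = - 1); last by rewrite -expr2 sqr_i.
  rewrite scaleN1r FN; apply/eqP; rewrite eq_complex /=.
  by apply/andP; split; apply/eqP; rewrite /=; ring.
exists f; split=> // x.
(* Rotating [x] by a unimodular [c] makes the value of [f] real and nonnegative, so that the bound
   on [F] applies to it. *)
have [c [c1 cE]] := unimodular_re (f x).
rewrite -cE.
have fZ : f (c *: x) = c * f x := linear_funZ fl c x.
by rewrite -fZ fF (le_trans (Fle _))// rnormZ c1 mul1r.
Qed.

(** The real part of [g], carried to the range of [V], is extended over the reals and then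
    complexified. On the range the result and [g] have the same real part, hence agree. *)
Lemma hahn_banach (X Z : normedModType K) (V : {linear Z -> X}) (g : Z -> K^o) :
  linear g -> (forall z, rnorm (g z) <= rnorm (V z)) ->
  exists f : X -> K^o, [/\ linear f, forall x, rnorm (f x) <= rnorm x &
    forall z, f (V z) = g z].
Proof.
move=> gl gle.
pose G := [set u | exists z, u = (V z, re (g z))].
have [|||r _ _ [z ->] [z' ->]|_ [z ->] /=|F [Fl Fle FG]] :=
    @hahn_banach_real R s X rnorm _ _ G.
- exact: rnormD.
- by move=> r x; rewrite rnormZ rnorm_of_real.
- by exists 0; rewrite linear0 (linear_fun0 gl) raddf0.
- by exists (r%:K *: z + z'); rewrite linearP gl raddfD /= scalar_reM.
- by rewrite (le_trans (ler_norm _))// (le_trans (ler_abs_re _)).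
have [f [fl fF fle]] := real_linear_scalar_re Fl Fle.
exists f; split=> //.
apply: linear_ext_re => //.
  by move=> a u v; rewrite linearP fl.
by move=> z; rewrite fF; apply: (FG (_, _)); exists z.
Qed.

(** Extends [t e -> t] from the real line through [e]. *)
Lemma norming_real_functional (X : normedModType K) (e : X) : rnorm e = 1 ->
  exists F : X -> R, [/\ real_linear F, forall x, `|F x| <= rnorm x & F e = 1].
Proof.
move=> e1.
pose G := [set u : X * R | exists t, u = (t%:K *: e, t)].
have [|||r _ _ [z ->] [z' ->]|_ [z ->] /=|F [Fl Fle FG]] :=
    @hahn_banach_real R s X rnorm _ _ G.
- exact: rnormD.
- by move=> r x; rewrite rnormZ rnorm_of_real.
- by exists 0; rewrite rmorph0 scale0r.
- by exists (r * z + z'); rewrite /= scalerA -scalerDl rmorphD rmorphM.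
- by rewrite rnormZ e1 mulr1 rnorm_of_real ler_norm.
exists F; split=> //.
  move=> x; rewrite ler_norml Fle andbT lerNl -(real_linearN Fl).
  by rewrite (le_trans (Fle _))// -scaleN1r -(rmorphN1 (of_real s)) rnormZ
    rnorm_of_real normrN1 mul1r.
by have := FG (1%:K *: e, 1); rewrite rmorph1 scale1r => ->//; exists 1;
  rewrite rmorph1 scale1r.
Qed.

End complexification.

(** * Injections into sets of sequences *)

Section embeddings.

Definition embeds {T U : Type} (A : set T) (B : set U) :=
  exists2 f : T -> U, set_fun A B f & set_inj A f.

Definition sequences_in {T : Type} (M : set T) : set (nat -> T) :=
  [set c | forall k, M (c k)].

Lemma embeds_trans {T U V : Type} (A : set T) (B : set U) (C : set V) :
  embeds A B -> embeds B C -> embeds A C.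
Proof.
move=> [f fAB fI] [g gBC gI]; exists (g \o f); first by move=> x /fAB /gBC.
move=> x y Ax Ay /= /gI E; apply: fI => //; apply: E.
- exact/mem_set/fAB/set_mem.
- exact/mem_set/fAB/set_mem.
Qed.

Lemma embeds_sequences_in {T U : Type} (A : set T) (B : set U) :
  embeds A B -> embeds (sequences_in A) (sequences_in B).
Proof.
move=> [f fAB fI]; exists (fun c k => f (c k)); first by move=> c Ac k; exact/fAB.
move=> c c' /set_mem Ac /set_mem Ac' E; apply/funext => k.
by apply: fI; [exact/mem_set|exact/mem_set|exact: (congr1 (fun h => h k) E)].
Qed.

Lemma embeds_cst {T : Type} (A : set T) : embeds A (sequences_in A).
Proof.
exists (fun x _ => x); first by move=> x Ax k.
by move=> x y _ _ /(congr1 (fun h => h 0%N)).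
Qed.

(** A double sequence is read off along an enumeration of the pairs of indices. *)
Lemma embeds_sequences_in2 {T : Type} (A : set T) :
  embeds (sequences_in (sequences_in A)) (sequences_in A).
Proof.
exists (fun c k => let: (i, j) := odflt (0, 0)%N (unpickle k) in c i j).
  by move=> c Ac k /=; case: (odflt _ _) => i j; exact: Ac.
move=> c c' _ _ E; apply/funext => i; apply/funext => j.
by have := congr1 (fun h => h (pickle (i, j))) E; rewrite /= pickleK.
Qed.

Lemma embeds_prod {T U V : Type} (A : set T) (B : set U) (M : set V) :
  embeds A (sequences_in M) -> embeds B (sequences_in M) ->
  embeds (A `*` B) (sequences_in M).
Proof.
move=> [f fA fI] [g gB gI]; apply: embeds_trans (embeds_sequences_in2 M).
(* The first coordinate is stored at index 0, the second at all other indices. *)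
exists (fun x k => if k is 0%N then f x.1 else g x.2).
  by move=> x [/= Ax Bx] [|k]; [exact: fA|exact: gB].
move=> [x y] [x' y'] /set_mem[/= Ax By] /set_mem[/= Ax' By'] E.
congr pair.
- by apply: fI; [exact/mem_set|exact/mem_set|exact: (congr1 (fun h => h 0%N) E)].
- by apply: gI; [exact/mem_set|exact/mem_set|exact: (congr1 (fun h => h 1%N) E)].
Qed.

(** A Dedekind cut: [m] and [m'] are the two digits that record which rationals lie below the real
    number. *)
Lemma embeds_real (R : realType) {T : Type} (M : set T) (m m' : T) :
  M m -> M m' -> m <> m' -> embeds [set: R] (sequences_in M).
Proof.
move=> Mm Mm' mm'.
exists (fun x k => if (ratr (odflt 0 (unpickle k : option rat)) : R) < x
                   then m else m').
  by move=> x _ k /=; case: ifP.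
have lt (x y : R) : x < y -> exists k,
    (if (ratr (odflt 0 (unpickle k : option rat)) : R) < x then m else m') <>
    (if (ratr (odflt 0 (unpickle k : option rat)) : R) < y then m else m').
  move=> xy; have [q] := rat_in_itvoo xy.
  rewrite in_itv /= => /andP[xq qy]; exists (pickle q).
  by rewrite pickleK /= qy ltNge (ltW xq) /= => /esym.
move=> x y _ _ E; apply: contrapT => /eqP; rewrite neq_lt => /orP[]/lt[k]; apply.
  exact: (congr1 (fun h => h k) E).
exact: (congr1 (fun h => h k) (esym E)).
Qed.

End embeddings.

(** Stands in for passing to the limit: by the Archimedean property and [k <= 2 ^+ k], the
    right-hand sides fall below any positive [a]. *)
Lemma geometric_le0 (R : realType) (q a C : R) :
  0 <= q <= 2^-1 -> (forall k, a <= q ^+ k * C) -> a <= 0.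
Proof.
move=> /andP[q0 q2] aq; rewrite leNgt; apply/negP => a0.
have C0 : 0 < C by have := aq 0%N; rewrite expr0 mul1r; exact: lt_le_trans.
have [k hk] : exists k : nat, C / a < k%:R.
  by exists (Num.bound (C / a)); rewrite archi_boundP// divr_ge0// ltW.
have qk : q ^+ k <= (2 ^+ k)^-1.
  by rewrite -exprVn lerXn2r ?nnegrE ?invr_ge0.
have : a <= (2 ^+ k)^-1 * C by rewrite (le_trans (aq k))// ler_wpM2r// ltW.
rewrite mulrC ler_pdivlMr ?exprn_gt0// => h.
have k2 : k%:R <= 2 ^+ k :> R by rewrite -natrX ler_nat ltnW// ltn_expl.
have : C < a * k%:R by rewrite -ltr_pdivrMl// mulrC.
by apply/negP; rewrite -leNgt (le_trans _ h)// ler_wpM2l// ltW.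
Qed.

(** * Real normed spaces, nets and codes by sequences *)

Section real_normed.
Context {R : realType} {s : scalars}.
Local Notation K := (scalar_field R s).
Local Notation "r %:K" := (of_real s r) (at level 2, format "r %:K").

(** A real norm on a real subspace of a [K]-module. With a set as carrier, one theory covers a
    Banach space, a real hyperplane in it, and a dual inside the space of all functions. *)
Record real_normed {E : lmodType K} (D : set E) (N : E -> R) : Prop := {
  domain0 : D 0 ;
  domainP : forall r x y, D x -> D y -> D (r%:K *: x + y) ;
  ler_normDx : forall x y, D x -> D y -> N (x + y) <= N x + N y ;
  normZx : forall r x, D x -> N (r%:K *: x) = `|r| * N x ;
  norm_eq0x : forall x, D x -> N x = 0 -> x = 0 }.

(* Completeness is only needed for sequences with a geometric rate of
   convergence; the factor 2 leaves room for limits of complex scalars that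
   are computed coordinatewise. *)
Definition real_complete {E : lmodType K} (D : set E) (N : E -> R) :=
  forall (u : nat -> E) (C : R), (forall n, D (u n)) ->
    (forall m n, (m <= n)%N -> N (u n - u m) <= 32^-1 ^+ m * C) ->
  exists x, D x /\ forall m, N (x - u m) <= 32^-1 ^+ m * (2 * C).

Definition sphere {E : lmodType K} (D : set E) (N : E -> R) : set E :=
  [set x | D x /\ N x = 1].

Section theory.
Context {E : lmodType K} {D : set E} {N : E -> R}.
Hypothesis DN : real_normed D N.

Lemma domainD x y : D x -> D y -> D (x + y).
Proof.
by move=> Dx Dy; have := domainP DN 1 Dx Dy; rewrite rmorph1 scale1r.
Qed.

Lemma domainZ r x : D x -> D (r%:K *: x).
Proof. by move=> Dx; have := domainP DN r Dx (domain0 DN); rewrite addr0. Qed.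

Lemma domainN x : D x -> D (- x).
Proof. by move/(domainZ (-1)); rewrite rmorphN1 scaleN1r. Qed.

Lemma domainB x y : D x -> D y -> D (x - y).
Proof. by move=> Dx Dy; apply: domainD => //; exact: domainN. Qed.

Lemma norm0x : N 0 = 0.
Proof. by have := normZx DN 0 (domain0 DN); rewrite scaler0 normr0 mul0r. Qed.

Lemma normNx x : D x -> N (- x) = N x.
Proof.
move=> Dx; have := normZx DN (-1) Dx.
by rewrite rmorphN1 scaleN1r normrN1 mul1r.
Qed.

Lemma norm_ge0x x : D x -> 0 <= N x.
Proof.
move=> Dx; have := ler_normDx DN Dx (domainN Dx).
by rewrite subrr norm0x normNx// -mulr2n pmulrn_lge0.
Qed.

Lemma normBC x y : D x -> D y -> N (x - y) = N (y - x).
Proof. by move=> Dx Dy; rewrite -normNx ?opprB//; exact: domainB. Qed.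

Lemma ler_normB_trans y x z : D x -> D y -> D z ->
  N (x - z) <= N (x - y) + N (y - z).
Proof.
move=> Dx Dy Dz; rewrite -[x in x - z](subrK y) -addrA.
by apply: (ler_normDx DN); exact: domainB.
Qed.

Lemma ler_normBx x y : D x -> D y -> N (x - y) <= N x + N y.
Proof.
by move=> Dx Dy; rewrite -(normNx Dy); apply: (ler_normDx DN) => //; exact: domainN.
Qed.

Lemma ler_dist_normx x y : D x -> D y -> `|N x - N y| <= N (x - y).
Proof.
move=> Dx Dy; rewrite ler_norml; apply/andP; split.
  rewrite normBC// lerNl opprB lerBlDr.
  by rewrite -{1}(subrK x y); apply: (ler_normDx DN) => //; exact: domainB.
by rewrite lerBlDr -{1}(subrK y x); apply: (ler_normDx DN) => //; exact: domainB.
Qed.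

Lemma sub_norm0_eq x y : D x -> D y -> N (x - y) <= 0 -> x = y.
Proof.
move=> Dx Dy xy; apply/eqP; rewrite -subr_eq0; apply/eqP.
have Dxy := domainB Dx Dy.
by apply: (norm_eq0x DN) => //; apply/eqP; rewrite eq_le xy norm_ge0x.
Qed.

Lemma norm_gt0x x : D x -> x <> 0 -> 0 < N x.
Proof.
move=> Dx x0; rewrite lt_neqAle norm_ge0x// andbT eq_sym; apply/eqP.
by move/(norm_eq0x DN Dx).
Qed.

Lemma sphere_normalize x : D x -> 0 < N x -> sphere D N ((N x)^-1%:K *: x).
Proof.
move=> Dx x0; split; first exact: domainZ.
by rewrite (normZx DN)// gtr0_norm ?invr_gt0// mulVf// gt_eqF.
Qed.

(** Normalizing moves [x] by [|N x - 1|], which is at most [N (x - e)]; hence the factor 2. *)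
Lemma normalize_dist x e r : D x -> sphere D N e -> N (x - e) <= r -> r < 1 ->
  0 < N x /\ N ((N x)^-1%:K *: x - e) <= 2 * r.
Proof.
move=> Dx [De e1] xe r1.
have := ler_dist_normx Dx De; rewrite e1 => /le_trans/(_ xe) xr.
have x0 : 0 < N x by move: xr; rewrite ler_norml => /andP[]; lra.
split=> //.
have Dx' := domainZ (N x)^-1 Dx.
rewrite (le_trans (ler_normB_trans Dx' Dx De))//.
rewrite mulr_natl mulr2n lerD//.
have -> : (N x)^-1%:K *: x - x = ((N x)^-1 - 1)%:K *: x.
  by rewrite rmorphB rmorph1 scalerBl scale1r.
rewrite (normZx DN)// -{2}(gtr0_norm x0) -normrM mulrBl mulVf ?gt_eqF//.
by rewrite mul1r distrC.
Qed.

(** A maximal [d]-separated subset is a [d]-net: a point farther than [d] from all of it could be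
    added. *)
Lemma exists_net (A : set E) (d : R) : 0 <= d -> A `<=` D ->
  exists M, [/\ M `<=` A, forall x y, M x -> M y -> x <> y -> d < N (x - y) &
    forall x, A x -> exists2 m, M m & N (x - m) <= d].
Proof.
move=> d0 AD.
pose P M := M `<=` A /\ forall x y, M x -> M y -> x <> y -> d < N (x - y).
have [F FP Ftot|M [[MA Msep] Mmax]] := @Zorn_bigcup _ P.
  split=> [x [B /FP[BA _] Bx]|x y [B FB Bx] [C FC Cy]]; first exact: BA.
  by have [BC|CB] := Ftot _ _ FB FC;
    [apply: (FP _ FC).2 => //; exact: BC|apply: (FP _ FB).2 => //; exact: CB].
exists M; split=> // x Ax; apply: contrapT => xM.
have far m : M m -> d < N (x - m).
  by move=> Mm; rewrite ltNge; apply/negP => xm; apply: xM; exists m.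
apply: (Mmax (M `|` [set x])).
  split; first by left.
  move=> /(_ x (or_intror erefl)) /far.
  by rewrite subrr norm0x ltNge d0.
split=> [y [/MA//|->//]|y z [My|->] [Mz|->] yz //]; first exact: Msep.
- by rewrite normBC; [exact: far|exact/AD/MA|exact: AD].
- exact: far.
Qed.

(** Greedy expansion: subtracting from [x] its norm times a net point near its direction leaves a
    remainder of norm at most [d * N x]. On iteration, the recorded norms and net points determine
    [x]. *)
Lemma embeds_codes (M : set E) (d : R) (m0 : E) : 0 <= d <= 2^-1 -> M m0 ->
  M `<=` D -> (forall x, sphere D N x -> exists2 m, M m & N (x - m) <= d) ->
  embeds D (sequences_in ([set: R] `*` M)).
Proof.
move=> d2 Mm0 MD Mnet.
have /choice[n nP] x : exists m, M m /\
    (D x -> N (x - (N x)%:K *: m) <= d * N x).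
  have [[Dx /eqP x0]|nx] := pselect (D x /\ N x != 0); last first.
    (* The point 0 and the points outside [D] receive the default [m0]. *)
    exists m0; split=> // Dx.
    have x0 : N x = 0 by apply: contrapT => /eqP x0; exact: nx.
    by rewrite (norm_eq0x DN Dx x0) norm0x rmorph0 scale0r subr0 norm0x mulr0.
  have xgt0 : 0 < N x by rewrite lt_neqAle norm_ge0x// andbT eq_sym; exact/eqP.
  have [m Mm xm] := Mnet _ (sphere_normalize Dx xgt0).
  exists m; split=> // _.
  have -> : x - (N x)%:K *: m = (N x)%:K *: ((N x)^-1%:K *: x - m).
    by rewrite scalerBr scalerA -rmorphM /= mulfV ?gt_eqF// rmorph1 scale1r.
  rewrite (normZx DN); last by apply: domainB; [exact: domainZ|exact: MD].
  by rewrite gtr0_norm// mulrC ler_pM2r.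
pose step x := x - (N x)%:K *: n x.
have stepD x : D x -> D (step x).
  by move=> Dx; apply: domainB => //; apply: domainZ; exact/MD/(nP x).1.
have iterD k x : D x -> D (iter k step x).
  by move=> Dx; elim: k => //= k; exact: stepD.
have iterN k x : D x -> N (iter k step x) <= d ^+ k * N x.
  move=> Dx; elim: k => [|k IHk] /=; first by rewrite expr0 mul1r.
  rewrite (le_trans ((nP _).2 (iterD _ _ Dx)))// exprS -mulrA.
  by rewrite ler_wpM2l//; case/andP: d2.
exists (fun x k => (N (iter k step x), n (iter k step x))).
  by move=> x Dx k; split=> //=; exact: (nP _).1.
move=> x y /set_mem Dx /set_mem Dy E'.
(* Equal codes mean that the same vectors are subtracted from [x] and [y], so the remainders keep
   the difference [x - y] while tending to 0. *)
have iterB k : iter k step x - iter k step y = x - y.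
  elim: k => //= k <-.
  have := congr1 (fun h => h k) E'; rewrite /= /step => -[-> ->].
  by rewrite opprB addrA subrK.
apply: sub_norm0_eq => //; apply: (@geometric_le0 _ d _ (N x + N y)) => // k.
rewrite -(iterB k) mulrDr (le_trans (ler_normBx (iterD k _ Dx) (iterD k _ Dy)))//.
by apply: lerD; exact: iterN.
Qed.

(** A sequence [c] goes to the sum of the [32^-k c_k]. At the first index [k] where two sequences
    differ, the terms are more than [32^-k / 2] apart, whereas both tails together amount to at most
    [8 * 32^-(k+1) = 32^-k / 4]. *)
Lemma sequences_embed (M : set E) : real_complete D N -> M `<=` sphere D N ->
  (forall x y, M x -> M y -> x <> y -> 2^-1 < N (x - y)) ->
  embeds (sequences_in M) D.
Proof.
move=> Dcomp MS Msep.
pose q : R := 32^-1.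
have q0 k : 0 <= q ^+ k by rewrite exprn_ge0// invr_ge0.
pose u (c : nat -> E) n := \sum_(k < n) (q ^+ k)%:K *: c k.
have uD c n : sequences_in M c -> D (u c n).
  move=> Mc; rewrite /u; elim: n => [|n IHn].
    by rewrite big_ord0; exact: (domain0 DN).
  rewrite big_ord_recr /=; apply: domainD => //.
  by apply: domainZ; exact: (MS _ (Mc n)).1.
have uN c m n : sequences_in M c -> (m <= n)%N ->
    N (u c n - u c m) <= q ^+ m * 2.
  move=> Mc /subnKC <-; set j := (n - m)%N.
  (* Subtracting the rest of the geometric bound makes the induction on [j] go through. *)
  suff : N (u c (m + j)%N - u c m) <= q ^+ m * 2 - q ^+ (m + j) * 2.
    move/le_trans; apply; have := q0 (m + j)%N; lra.
  elim: j => [|j IHj]; first by rewrite addn0 !subrr norm0x.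
  rewrite addnS {1}/u big_ord_recr /= -/(u c (m + j)%N) addrAC.
  have Dc := (MS _ (Mc (m + j)%N)).1.
  rewrite (le_trans (ler_normDx DN _ _))//.
  - by apply: domainB; exact: uD.
  - exact: domainZ.
  rewrite (normZx DN)// (MS _ (Mc (m + j)%N)).2 mulr1 ger0_norm//.
  move: IHj; rewrite [q ^+ (m + j).+1]exprS.
  by have := q0 (m + j)%N; rewrite /q; lra.
(* The constant 2 of the partial sums is doubled by [real_complete]. *)
have /choice[L LP] c : exists x, sequences_in M c ->
    D x /\ forall m, N (x - u c m) <= q ^+ m * 4.
  have [Mc|nMc] := pselect (sequences_in M c); last by exists 0.
  have [n|k n kn|x [Dx xu]] := Dcomp (u c) 2; [exact: uD|exact: uN|].
  exists x => _; split=> // m; rewrite (le_trans (xu m))//.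
  by rewrite ler_wpM2l//; lra.
exists L; first by move=> c /LP[].
move=> c c' /set_mem Mc /set_mem Mc' LE; apply/funext => k.
elim/ltn_ind: k => k IHk; apply: contrapT => neq.
have uk : u c k = u c' k by apply: eq_bigr => i _; rewrite IHk.
have [Dx xu] := LP _ Mc; have [Dx' xu'] := LP _ Mc'.
have := ler_normB_trans (uD _ k.+1 Mc) Dx (uD _ k.+1 Mc').
have -> : u c k.+1 - u c' k.+1 = (q ^+ k)%:K *: (c k - c' k).
  by rewrite {1 2}/u !big_ord_recr /= -/(u c k) -/(u c' k) uk scalerBr opprD
    addrACA subrr add0r.
have Dc := (MS _ (Mc k)).1; have Dc' := (MS _ (Mc' k)).1.
rewrite (normZx DN); last exact: domainB.
rewrite ger0_norm// (normBC (uD _ k.+1 Mc) Dx).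
have := xu k.+1; have := xu' k.+1; rewrite -LE exprS.
have := Msep _ _ (Mc k) (Mc' k) neq.
have qk : 0 < q ^+ k by rewrite exprn_gt0// invr_gt0.
move=> sep; have : q ^+ k * 2^-1 < q ^+ k * N (c k - c' k) by rewrite ltr_pM2l.
by rewrite /q in qk *; lra.
Qed.

End theory.
End real_normed.

(** * Injections between unit spheres *)

Section sphere_injection.
Context {R : realType} {s : scalars}.
Local Notation K := (scalar_field R s).
Local Notation "r %:K" := (of_real s r) (at level 2, format "r %:K").

Lemma scaler_of_real_inj (E : lmodType K) (r : R) : r != 0 ->
  injective (fun x : E => r%:K *: x).
Proof.
by move=> r0; apply: (can_inj (g := fun x : E => r^-1%:K *: x)) => x;
  rewrite scalerA -rmorphM /= mulVf// rmorph1 scale1r.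
Qed.

Section kernel.
Context {E : lmodType K} (D : set E) (N : E -> R) (f : E -> R).
Hypotheses (DN : real_normed D N) (fl : real_linear f).
Hypothesis fN : forall x, D x -> `|f x| <= N x.

Definition kernel : set E := [set x | D x /\ f x = 0].

Lemma kernel_normed : real_normed kernel N.
Proof.
split.
- by split; [exact: (domain0 DN)|exact: (real_linear0 fl)].
- move=> r x y [Dx fx] [Dy fy]; split; first exact: (domainP DN).
  by rewrite fl fx fy mulr0 addr0.
- by move=> x y [Dx _] [Dy _]; exact: (ler_normDx DN).
- by move=> r x [Dx _]; exact: (normZx DN).
- by move=> x [Dx _]; exact: (norm_eq0x DN).
Qed.

Lemma kernel_complete : real_complete D N -> real_complete kernel N.
Proof.
move=> Dcomp u C uK uC.
have [|x [Dx xu]] := Dcomp u C _ uC; first by move=> n; exact: (uK n).1.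
exists x; split=> //; split=> //.
apply/eqP; rewrite -normr_le0; apply: (@geometric_le0 _ 32^-1 _ (2 * C)).
  by apply/andP; split; lra.
move=> k; rewrite (le_trans _ (xu k))//.
rewrite -[f x]subr0 -(uK k).2 -(real_linearB fl); apply: fN.
by apply: (domainB DN) => //; exact: (uK k).1.
Qed.

(** The real line through [e0] is complementary to the kernel. *)
Lemma embeds_kernel_prod (e0 : E) : D e0 -> f e0 = 1 ->
  embeds D (kernel `*` [set: R]).
Proof.
move=> De0 fe0; exists (fun x => (x - (f x)%:K *: e0, f x)).
  move=> x Dx; split=> //; split=> /=.
    by apply: (domainB DN) => //; exact: (domainZ DN).
  by rewrite (real_linearB fl) (real_linearZ fl) fe0 mulr1 subrr.
by move=> x y _ _ [+ fxy]; rewrite fxy => /addIr.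
Qed.

Lemma sphere_off_kernel (e0 e : E) (eta : R) : D e0 -> f e0 = 1 ->
  sphere D N e -> 0 < eta < 1 ->
  exists e', [/\ sphere D N e', f e' != 0 & N (e' - e) <= eta].
Proof.
move=> De0 fe0 [De e1] /andP[eta0 eta1].
have [fe|fe] := eqVneq (f e) 0; last first.
  by exists e; split=> //; rewrite subrr (norm0x DN) ltW.
have e00 : 0 < N e0.
  apply: (norm_gt0x DN) => // E0; move: fe0.
  by rewrite E0 (real_linear0 fl) => /eqP; rewrite eq_sym oner_eq0.
(* The vector [t e0] has norm [eta / 2], and normalization at most doubles the displacement. *)
pose t := eta / (2 * N e0).
have t0 : 0 < t by rewrite divr_gt0// mulr_gt0.
have Dt : D (t%:K *: e0 + e) by exact: (domainP DN).
have [|||v0 ve] := @normalize_dist _ _ _ _ _ DN _ e (eta / 2) Dt.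
- by [].
- rewrite addrK (normZx DN)// gtr0_norm// /t invfM mulrA mulfVK ?gt_eqF//.
- by lra.
exists ((N (t%:K *: e0 + e))^-1%:K *: (t%:K *: e0 + e)); split.
- exact: (sphere_normalize DN).
- rewrite (real_linearZ fl) fl fe fe0 mulr1 addr0 mulf_neq0// ?invr_eq0 gt_eqF//.
- by rewrite (le_trans ve)//; lra.
Qed.

(* Points of the domain are coded by sequences of points of a 1/2-net of the
   unit sphere of the kernel, and such sequences are coded in turn by series
   in the kernel. *)
Lemma embeds_net_kernel (w : E) : real_complete D N -> kernel w -> w <> 0 ->
  exists2 M : set E, embeds [set: R] (sequences_in M) &
    embeds kernel (sequences_in M) /\ embeds (sequences_in M) kernel.
Proof.
move=> Dcomp Kw w0; have KN := kernel_normed.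
have [M [MS Msep Mnet]] := @exists_net _ _ _ _ _ KN (sphere kernel N) 2^-1
  ltac:(lra) (fun x => @proj1 _ _).
have Sw := sphere_normalize KN Kw (norm_gt0x KN Kw w0).
set v := (_ *: w) in Sw.
have SNv : sphere kernel N (- v).
  by split; [exact: (domainN KN) Sw.1|rewrite (normNx KN) ?Sw.2//; exact: Sw.1].
have [m Mm vm] := Mnet _ Sw; have [m' Mm' vm'] := Mnet _ SNv.
(* These are the two digits for coding reals: [v] and [- v] are at distance 2, and a common net
   point would be within 1/2 of both. *)
have mm' : m <> m'.
  move=> E'; rewrite -E' in vm'.
  have := ler_normBx KN (domainB KN Sw.1 (MS _ Mm).1) (domainB KN SNv.1 (MS _ Mm).1).
  have -> : v - m - (- v - m) = 2%:K *: v.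
    by rewrite opprB opprK addrA subrK -mulr2n -scaler_nat rmorphMn rmorph1.
  rewrite (normZx KN) ?Sw.2; last exact: Sw.1.
  by rewrite normr_nat; lra.
have RM := embeds_real R Mm Mm' mm'.
exists M => //; split; last exact: (sequences_embed KN (kernel_complete Dcomp)).
apply: embeds_trans (embeds_sequences_in2 M).
apply: (embeds_trans (B := sequences_in ([set: R] `*` M))).
  apply: (embeds_codes KN (d := 2^-1) (m0 := m)) => //; first by lra.
  by move=> x /MS[].
by apply/embeds_sequences_in/embeds_prod => //; exact: embeds_cst.
Qed.

End kernel.

Context {E F : lmodType K} (D : set E) (N : E -> R) (D' : set F) (N' : F -> R).
Context (f : E -> R) (e0 : E).
Hypotheses (DN : real_normed D N) (DN' : real_normed D' N').
Hypothesis Dcomp : real_complete D N.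
Hypotheses (fl : real_linear f) (fN : forall x, D x -> `|f x| <= N x).
Hypotheses (De0 : D e0) (fe0 : f e0 = 1).
Local Notation S := (sphere D N).
Local Notation S' := (sphere D' N').

(* If z2 = z1 + t v is a unit vector with small t, then v is far from - z1
   (otherwise z2 would have norm less than 1), and likewise from z2. *)
Lemma sphere_third_point (d : R) z1 z2 : S' z1 -> S' z2 -> z1 <> z2 ->
  0 <= d < 2^-1 -> N' (z2 - z1) <= d ->
  exists v, [/\ S' v, d < N' (v - z1) & d < N' (v + z1)].
Proof.
move=> [Dz1 z11] [Dz2 z21] z12 /andP[d0 d2] zd.
have Dz := domainB DN' Dz2 Dz1.
have t0 : 0 < N' (z2 - z1).
  by apply: (norm_gt0x DN') => //; move/eqP; rewrite subr_eq0 eq_sym => /eqP.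
set t := N' (z2 - z1) in t0 zd.
have Sv := sphere_normalize DN' Dz t0; set v := (_ *: _) in Sv.
have [Dv v1] := Sv.
have tv : t%:K *: v = z2 - z1.
  by rewrite scalerA -rmorphM /= mulfV ?gt_eqF// rmorph1 scale1r.
have convex x y : D' x -> D' y -> N' x = 1 ->
    N' ((1 - t)%:K *: x + t%:K *: y) = 1 -> 1 <= N' y.
  move=> Dx Dy x1 xy1.
  have := ler_normDx DN' (domainZ DN' (1 - t) Dx) (domainZ DN' t Dy).
  rewrite xy1 !(normZx DN')// x1 ger0_norm ?subr_ge0; last by lra.
  rewrite gtr0_norm// => h; have : t * 1 <= t * N' y by lra.
  by rewrite ler_pM2l.
exists v; split=> //; last first.
  rewrite (lt_le_trans (_ : d < 1))//; first by lra.
  apply: (convex z1) => //; first exact: (domainD DN').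
  rewrite scalerDr tv addrCA -scalerDl -rmorphD subrK rmorph1 scale1r.
  by rewrite subrK.
(* Here [z1 = (1 - t) z2 + t (z2 - v)]. Replacing [z2] by [z1] then costs [t <= d], and
   [1 - d > d]. *)
have : 1 <= N' (v - z2).
  rewrite (normBC DN')//; apply: (convex z2) => //; first exact: (domainB DN').
  rewrite scalerBr tv opprB addrA -scalerDl -rmorphD subrK rmorph1 scale1r.
  by rewrite addrCA subrr addr0.
have := ler_normB_trans DN' Dv Dz1 Dz2; rewrite (normBC DN' Dz1 Dz2) -/t; lra.
Qed.

Context (phi : F -> E) (delta rho eta : R).
Hypothesis phiS : set_fun S' S phi.
Hypotheses (delta2 : 0 <= delta < 2^-1) (rho0 : 0 < rho).
Hypothesis phisep : forall z z', S' z -> S' z' -> delta < N' (z - z') ->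
  rho <= N (phi z - phi z').

Let phi_neq z z' : S' z -> S' z' -> delta < N' (z - z') -> phi z <> phi z'.
Proof.
move=> Sz Sz' /(phisep Sz Sz') + E'.
by rewrite E' subrr (norm0x DN) leNgt rho0.
Qed.

(** The unit sphere of a real line has only two points. If [phi] identified [z1] and [z2], these
    would be within [delta], and their third point [v] would make [phi v], [phi z1] and [phi (- z1)]
    three distinct values. *)
Lemma inj_of_trivial_kernel : (forall x, kernel D f x -> x = 0) ->
  set_inj S' phi.
Proof.
move=> K0.
have line x : D x -> x = (f x)%:K *: e0.
  move=> Dx; apply/eqP; rewrite -subr_eq0; apply/eqP/K0; split.
    by apply: (domainB DN) => //; exact: (domainZ DN).
  by rewrite (real_linearB fl) (real_linearZ fl) fe0 mulr1 subrr.
have fS x y : S x -> S y -> (f x < 0) = (f y < 0) -> x = y.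
  move=> [Dx x1] [Dy y1] xy; rewrite (line _ Dx) (line _ Dy); congr (_ %:K *: _).
  have xE : `|f x| * N e0 = 1 by rewrite -(normZx DN)// -line.
  have yE : `|f y| * N e0 = 1 by rewrite -(normZx DN)// -line.
  have e00 : N e0 != 0.
    by apply/eqP => e00; move: xE; rewrite e00 mulr0 => /eqP; rewrite eq_sym oner_eq0.
  have : `|f x| = `|f y| by apply: (mulIf e00); rewrite xE yE.
  by move: xy; case: ltP => fx; case: ltP => fy // _;
    rewrite ?(ltr0_norm fx) ?(ltr0_norm fy) ?(ger0_norm fx) ?(ger0_norm fy)//;
    move/oppr_inj.
have two x y z : S x -> S y -> S z -> x <> y -> x <> z -> y = z.
  move=> Sx Sy Sz xy xz; apply: (fS) => //.
  have := fS _ _ Sx Sy; have := fS _ _ Sx Sz.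
  by case: (f x < 0); case: (f y < 0); case: (f z < 0) => // h1 h2;
    by [case: xz; exact: h1|case: xy; exact: h2].
move=> z1 z2 /set_mem Sz1 /set_mem Sz2 E12; apply: contrapT => z12.
have [|zd] := ltP delta (N' (z2 - z1)).
  by move=> /(phi_neq Sz2 Sz1); rewrite E12.
have [v [Sv vz1 vNz1]] := sphere_third_point Sz1 Sz2 z12 delta2 zd.
have SN : S' (- z1).
  by split; [exact: (domainN DN') Sz1.1|rewrite (normNx DN') ?Sz1.2//; exact: Sz1.1].
have h1 := phi_neq Sv Sz1 vz1.
have h2 : phi v <> phi (- z1) by apply: phi_neq => //; rewrite opprK.
apply: (phi_neq Sz1 SN); last by apply: (two (phi v)) => //; exact: phiS.
rewrite opprK -mulr2n -scaler_nat.
have -> : 2%:R = 2%:K :> K by rewrite rmorphMn rmorph1.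
rewrite (normZx DN'); last exact: Sz1.1.
by rewrite Sz1.2 normr_nat; case/andP: delta2; lra.
Qed.

Hypothesis eta0 : 0 < eta.

Lemma sphere_injection : exists g : F -> E, [/\ set_fun S' S g, set_inj S' g &
  forall z, S' z -> exists z', [/\ S' z', N' (z - z') <= delta &
    N (g z - phi z') <= eta]].
Proof.
(* An injective [phi] serves as [g]; this settles an empty [S'] and a trivial kernel. *)
have trivial : set_inj S' phi -> exists g : F -> E,
    [/\ set_fun S' S g, set_inj S' g &
  forall z, S' z -> exists z', [/\ S' z', N' (z - z') <= delta &
    N (g z - phi z') <= eta]].
  move=> phiI; exists phi; split=> // z Sz; exists z; split=> //.
    by rewrite subrr (norm0x DN'); case/andP: delta2.
  by rewrite subrr (norm0x DN) ltW.
have [[z0 Sz0]|nS'] := pselect (exists z, S' z); last first.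
  by apply: trivial => z z' /set_mem Sz; case: nS'; exists z.
have [K0|] := pselect (forall x, kernel D f x -> x = 0).
  exact/trivial/inj_of_trivial_kernel.
move=> /existsNP[w /not_implyP[Kw w0]].
have KN := kernel_normed DN fl.
have [M RM [KM MK]] := embeds_net_kernel DN fl fN Dcomp Kw w0.
have delta0 : 0 <= delta by case/andP: delta2.
have [P [PS Psep Pnet]] := exists_net DN' delta0 (fun x => @proj1 _ _ : S' x -> D' x).
have [m0 Pm0 z0m0] := Pnet _ Sz0.
(* The map [phi] is injective on the separated set [P], and [D] is coded as kernel times reals. *)
have PM : embeds P (sequences_in M).
  apply: (embeds_trans (B := D)).
    exists phi; first by move=> z /PS /phiS[].
    move=> z z' /set_mem Pz /set_mem Pz' E'; apply: contrapT => zz'.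
    by apply: (phi_neq (PS _ Pz) (PS _ Pz')) => //; exact: Psep.
  apply: embeds_trans (embeds_kernel_prod DN fl De0 fe0) _.
  exact: embeds_prod.
have [h0 h0K h0I] : embeds D' (kernel D f).
  apply: embeds_trans MK; apply: embeds_trans (embeds_sequences_in2 M).
  apply: (embeds_trans (B := sequences_in ([set: R] `*` P))).
    apply: (embeds_codes DN' (d := delta) (m0 := m0)) => //.
      by rewrite delta0 ltW//; case/andP: delta2.
    by move=> z /PS[].
  by apply/embeds_sequences_in/embeds_prod.
(* The rescaling puts [h] in the unit ball and keeps it injective, because the norm [1 - a z] of
   [h z] gives back the factor [a z]. *)
pose a z := (1 + N (h0 z))^-1; pose h z := (a z)%:K *: h0 z.
have a0 z : D' z -> 0 < a z.
  by move=> /h0K/(norm_ge0x KN) h0z; rewrite invr_gt0 ltr_pwDl.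
have hK z : D' z -> kernel D f (h z).
  by move=> /h0K Kz; exact: (domainZ KN).
have Nh z : D' z -> N (h z) = 1 - a z.
  move=> Dz; rewrite (normZx KN) ?gtr0_norm ?a0//; last exact: h0K.
  have : a z * (1 + N (h0 z)) = 1.
    by rewrite mulVf// gt_eqF// -invr_gt0 a0.
  by rewrite mulrDr mulr1; lra.
have hI : set_inj D' h.
  move=> z z' Dz Dz' E'; apply: h0I => //.
  have {}Dz := set_mem Dz; have {}Dz' := set_mem Dz'.
  have azz' : a z = a z'.
    by apply/oppr_inj/(addrI 1); rewrite -!Nh// E'.
  by move: E'; rewrite /h -azz' => /scaler_of_real_inj; apply; rewrite gt_eqF// a0.
pose et := Num.min eta (Num.min rho 1).
have et0 : 0 < et by rewrite !lt_min eta0 rho0 ltr01.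
have et1 : et <= 1 by rewrite !ge_min lexx !orbT.
have et_rho : et <= rho by rewrite !ge_min lexx !orbT.
have et_eta : et <= eta by rewrite !ge_min lexx.
have /choice[n nP] z : exists n, S' z -> P n /\ N' (z - n) <= delta.
  by have [/Pnet[n]|nz] := pselect (S' z); [exists n|exists 0].
have /choice[e eP] z : exists e, S' z ->
    [/\ S e, f e != 0 & N (e - phi z) <= et / 4].
  have [Sz|nz] := pselect (S' z); last by exists 0.
  have [|e he] := sphere_off_kernel DN fl De0 fe0 (phiS Sz) (eta := et / 4).
    by apply/andP; split; lra.
  by exists e.
(* The images lie within [2 r = et / 8] of [e], which is within [et / 4] of [phi]. Over different
   net points they stay apart, since twice [3 et / 8] is less than [rho]. *)
pose r := et / 16.
pose v z := r%:K *: h z + e (n z).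
have vP z : S' z -> [/\ D (v z), 0 < N (v z) &
    N ((N (v z))^-1%:K *: v z - e (n z)) <= 2 * r].
  move=> Sz; have [Pn _] := nP z Sz; have [Se _ _] := eP _ (PS _ Pn).
  have Kh := hK z Sz.1.
  have Dv : D (v z) by apply: (domainP DN) => //; [exact: Kh.1|exact: Se.1].
  suff vr : N (v z - e (n z)) <= r.
    by have [|v0 ve] := normalize_dist DN Dv Se vr; [rewrite /r; lra|].
  rewrite /v addrK (normZx DN); last exact: Kh.1.
  have az := a0 _ Sz.1; have r0 : 0 < r by rewrite divr_gt0.
  rewrite Nh; last exact: Sz.1.
  by rewrite gtr0_norm// ler_piMr ?ltW//; lra.
exists (fun z => (N (v z))^-1%:K *: v z); split.
- by move=> z Sz; have [Dv v0 _] := vP z Sz; exact: (sphere_normalize DN).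
- move=> z z' /set_mem Sz /set_mem Sz' E'.
  have [Dv v0 ve] := vP z Sz; have [Dv' v0' ve'] := vP z' Sz'.
  have [Pn zn] := nP z Sz; have [Pn' zn'] := nP z' Sz'.
  have [Se fe en] := eP _ (PS _ Pn); have [Se' fe' en'] := eP _ (PS _ Pn').
  have nn' : n z = n z'.
    apply: contrapT => nn'.
    have := phisep (PS _ Pn) (PS _ Pn') (Psep _ _ Pn Pn' nn').
    have Dp := (phiS (PS _ Pn)).1; have Dp' := (phiS (PS _ Pn')).1.
    have Dg := domainZ DN (N (v z))^-1 Dv.
    have Dg' := domainZ DN (N (v z'))^-1 Dv'.
    have := ler_normB_trans DN Dp Se.1 Dp'.
    have := ler_normB_trans DN Se.1 Dg Dp'.
    have := ler_normB_trans DN Dg Se'.1 Dp'.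
    rewrite {2}E' (normBC DN Dp Se.1) (normBC DN Se.1 Dg).
    move: ve ve' en en'; rewrite /r; lra.
  (* As [f] vanishes on the kernel, [f (v z)] depends on the net point only and is nonzero. Equal
     images therefore force equal norms of [v z] and [v z'], and then [h z = h z']. *)
  have fv : f (v z) = f (v z').
    by rewrite /v !fl (hK z Sz.1).2 (hK z' Sz'.1).2 nn'.
  have fv0 : f (v z) != 0 by rewrite /v fl (hK z Sz.1).2 mulr0 add0r.
  have vv' : (N (v z))^-1 = (N (v z'))^-1.
    have := congr1 f E'; rewrite !(real_linearZ fl) -fv => h'.
    exact: (mulIf fv0).
  have r0 : r != 0 by rewrite gt_eqF// divr_gt0.
  move: E'; rewrite -vv' => /scaler_of_real_inj.
  rewrite invr_eq0 gt_eqF// => /(_ isT).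
  rewrite /v nn' => /addIr /(scaler_of_real_inj r0).
  by apply: hI; apply/mem_set; [exact: Sz.1|exact: Sz'.1].
- move=> z Sz; have [Dv v0 ve] := vP z Sz; have [Pn zn] := nP z Sz.
  have [Se fe en] := eP _ (PS _ Pn).
  exists (n z); split=> //; first exact: PS.
  have Dg := domainZ DN (N (v z))^-1 Dv.
  have := ler_normB_trans DN Dg Se.1 (phiS (PS _ Pn)).1.
  by move: ve; rewrite /r; lra.
Qed.

End sphere_injection.

(** * Completeness of Banach spaces and of the scalars *)

Section banach_spaces.
Context {R : realType} {s : scalars}.
Local Notation K := (scalar_field R s).
Local Notation "r %:K" := (of_real s r) (at level 2, format "r %:K").

Lemma rnorm_real_normed (Y : normedModType K) :
  real_normed [set: Y] (@rnorm R s Y).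
Proof.
split=> //.
- by move=> x y _ _; exact: rnormD.
- by move=> r x _; rewrite rnormZ rnorm_of_real.
- by move=> x _; exact: rnorm0_eq0.
Qed.

Lemma rnorm_geometric_limit (Y : completeNormedModType K) (u : nat -> Y) C :
  (forall m n, (m <= n)%N -> rnorm (u n - u m) <= 32^-1 ^+ m * C) ->
  exists x, forall m, rnorm (x - u m) <= 32^-1 ^+ m * C.
Proof.
move=> uC; have YN := rnorm_real_normed Y.
have u_cauchy : cauchy (u n @[n --> \oo]).
  apply: cauchy_exP => e e0.
  have := ge0_scalar_re (ltW e0); move: (scalar_re e) => r re; move: e0.
  rewrite -{}re -{1}(rmorph0 (of_real s)) ltr_of_real => r0.
  have [m um] : exists m, 32^-1 ^+ m * C < r.
    apply: contrapT => /forallNP um; move: r0; apply/negP; rewrite -leNgt.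
    apply: (@geometric_le0 _ 32^-1 _ C); first by apply/andP; split; lra.
    by move=> k; rewrite leNgt; apply/negP.
  exists (u m), m => //= n /= mn; rewrite -ball_normE /=.
  by rewrite distrC rnormE ltr_of_real (le_lt_trans (uC _ _ mn)).
have /cvg_ex[x ux] : cvg (u n @[n --> \oo]) by exact: cauchy_cvg.
exists x => m; apply/ler_addgt0Pr => e e0.
have /cvgrPdist_lt/(_ e%:K) := ux.
rewrite -(rmorph0 (of_real s)) ltr_of_real => /(_ e0)[n0 _ xn].
have := xn (maxn n0 m) (leq_maxl _ _); rewrite rnormE ltr_of_real => /ltW xu.
have := ler_normB_trans YN (I : setT x) (I : setT (u (maxn n0 m))) (I : setT (u m)).
by have := uC m (maxn n0 m) (leq_maxr _ _); lra.
Qed.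

Lemma rnorm_real_complete (Y : completeNormedModType K) :
  real_complete [set: Y] (@rnorm R s Y).
Proof.
move=> u C _ uC; have [x xu] := rnorm_geometric_limit uC.
exists x; split=> // m; rewrite (le_trans (xu m))// ler_wpM2l ?exprn_ge0 ?invr_ge0//.
have := uC 0%N 0%N isT; rewrite expr0 mul1r.
by have := rnorm_ge0 (u 0%N - u 0%N); lra.
Qed.

End banach_spaces.

Lemma sqrt_sumsq_le (R : rcfType) (a b : R) :
  Num.sqrt (a ^+ 2 + b ^+ 2) <= `|a| + `|b|.
Proof.
rewrite -[leRHS]ger0_norm ?addr_ge0// -(sqrtr_sqr (`|a| + `|b|)) ler_wsqrtr//.
rewrite sqrrD !real_normK ?num_real// addrAC lerDl.
by rewrite mulrn_wge0// mulr_ge0.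
Qed.

Lemma rnorm_complexE (R : realType) (z : R[i]) :
  rnorm (z : (scalar_field R ComplexScalars)^o) =
  Num.sqrt (complex.Re z ^+ 2 + complex.Im z ^+ 2).
Proof. exact: (congr1 (@complex.Re R) (normc_def z)). Qed.

(** A complex limit is taken coordinatewise; the modulus is at most the sum of the absolute values
    of the coordinates, whence the factor 2. *)
Lemma scalar_geometric_limit (R : realType) (s : scalars)
    (u : nat -> scalar_field R s) C :
  (forall m n, (m <= n)%N ->
    rnorm (u n - u m : (scalar_field R s)^o) <= 32^-1 ^+ m * C) ->
  exists x, forall m,
    rnorm (x - u m : (scalar_field R s)^o) <= 32^-1 ^+ m * (2 * C).
Proof.
have q0 m : 0 <= 32^-1 ^+ m :> R by rewrite exprn_ge0// invr_ge0.
case: s u => u uC.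
  have [x [_ xu]] := @rnorm_real_complete R RealScalars R^o u C (fun=> I) uC.
  by exists x.
have limit (h : R[i] -> R) : (forall z w, h (z - w) = h z - h w) ->
    (forall z, `|h z| <= @rnorm R ComplexScalars R[i]^o z) ->
    exists x : R, forall m, `|x - h (u m)| <= 32^-1 ^+ m * C.
  move=> hB hle.
  have [|x xu] := @rnorm_geometric_limit R RealScalars R^o (h \o u) C; last first.
    by exists x.
  move=> m n mn; rewrite (le_trans _ (uC _ _ mn))//.
  by rewrite /rnorm /= -hB; exact: hle.
have [|z|a au] := limit (@complex.Re R).
- by move=> [? ?] [? ?].
- exact: (@ler_abs_re R ComplexScalars).
have [|z|b bu] := limit (@complex.Im R).
- by move=> [? ?] [? ?].
- by rewrite rnorm_complexE -sqrtr_sqr ler_wsqrtr// lerDr sqr_ge0.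
exists (Complex a b) => m; rewrite rnorm_complexE.
move: (au m) (bu m); case: (u m) => x y /= ax byy.
rewrite mulrCA mulr2n mulrDl mul1r (le_trans _ (lerD ax byy))//.
exact: sqrt_sumsq_le.
Qed.

(** * The dual as a complete real normed space *)

Section dual.
Context {R : realType} {s : scalars}.
Local Notation K := (scalar_field R s).
Local Notation "r %:K" := (of_real s r) (at level 2, format "r %:K").

Section theory.
Context {Y : normedModType K}.
Implicit Types (f : Y -> K^o) (y : Y).

Definition dual : set (Y -> K^o) := [set f | linear f /\ continuous f].

(** Faithful on [dual], where the supremum is finite. *)
Definition dnorm f : R := fine (dual_norm f).

Lemma dual_bounded f : dual f ->
  exists2 C, 0 <= C & forall y, rnorm (f y) <= C * rnorm y.
Proof.
move=> [fl fc].
pose g : {linear Y -> K^o} := HB.pack f (GRing.isLinear.Build _ _ _ _ f fl).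
have /linear_bounded_continuous/linear_boundedP[M [Mreal gM]] : continuous g by [].
exists (rnorm (M : K^o) + 1); first by rewrite addr_ge0// rnorm_ge0.
have MM : M < (rnorm (M : K^o) + 1)%:K.
  have <- : `|M| + 1 = (rnorm (M : K^o) + 1)%:K.
    by rewrite rmorphD rmorph1; congr (_ + 1); exact: (rnormE (M : K^o)).
  by rewrite ltr_pwDr// real_ler_norm.
by move=> y; have := gM _ MM y; rewrite !rnormE -rmorphM ler_of_real.
Qed.

Lemma bounded_dual f C : linear f -> (forall y, rnorm (f y) <= C * rnorm y) ->
  dual f.
Proof.
move=> fl fC; split=> //.
pose g : {linear Y -> K^o} := HB.pack f (GRing.isLinear.Build _ _ _ _ f fl).
suff : continuous g by [].
apply/linear_bounded_continuous/linear_boundedP.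
exists C%:K; split=> [|M CM y].
  by rewrite realE -(rmorph0 (of_real s)) !ler_of_real -realE num_real.
rewrite rnormE (le_trans _ (ler_wpM2r _ (ltW CM)))// rnormE -rmorphM ler_of_real.
exact: fC.
Qed.

Lemma dnorm_le f C : 0 <= C -> (forall y, rnorm (f y) <= C * rnorm y) ->
  (0 <= dual_norm f <= C%:E)%E.
Proof.
move=> C0 fC; apply/andP; split.
  apply: (@le_trans _ _ (enorm (f 0))); first by rewrite enormE lee_fin rnorm_ge0.
  by apply: ereal_sup_ubound; exists 0 => //=; rewrite normr0.
apply: ge_ereal_sup => _ [y /= y1 <-]; rewrite enormE lee_fin.
rewrite (le_trans (fC y))// ler_piMr//.
by move: y1; rewrite rnormE -{1}(rmorph1 (of_real s)) ler_of_real.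
Qed.

Lemma dual_normE f : dual f -> dual_norm f = (dnorm f)%:E.
Proof.
move=> /dual_bounded[C C0 /(dnorm_le C0)/andP[f0 fC]].
rewrite /dnorm fineK// fin_numE -ltNye -ltey.
by rewrite (lt_le_trans _ f0)// (le_lt_trans fC)// ltry.
Qed.

Lemma dnorm_ub f C : 0 <= C -> (forall y, rnorm (f y) <= C * rnorm y) ->
  dnorm f <= C.
Proof.
move=> C0 fC; have /andP[f0 f1] := dnorm_le C0 fC.
by rewrite /dnorm -lee_fin fineK// fin_numE -ltNye -ltey
  (lt_le_trans _ f0)// (le_lt_trans f1)// ltry.
Qed.

Lemma dnorm_ge0 f : dual f -> 0 <= dnorm f.
Proof.
move=> fd; rewrite -lee_fin -dual_normE//.
by have [C C0 /(dnorm_le C0)/andP[]] := dual_bounded fd.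
Qed.

Lemma dnormP f y : dual f -> rnorm (f y) <= dnorm f * rnorm y.
Proof.
move=> fd; have [->|/eqP y0] := eqVneq y 0.
  by rewrite (linear_fun0 fd.1) /rnorm !normr0 !raddf0 mulr0.
have YN := rnorm_real_normed Y.
have := norm_gt0x YN (I : setT y) y0 => y1.
have [_ Sy] := sphere_normalize YN (I : setT y) y1.
rewrite -ler_pdivrMr// mulrC.
have -> : (rnorm y)^-1 * rnorm (f y) = rnorm (f ((rnorm y)^-1%:K *: y)).
  by rewrite (linear_funZ fd.1) rnormZ rnorm_of_real ger0_norm// invr_ge0 rnorm_ge0.
rewrite -lee_fin -dual_normE//; apply: ereal_sup_ubound.
by exists ((rnorm y)^-1%:K *: y) => //=; rewrite rnormE Sy rmorph1.
Qed.

Lemma dual_sphereE : @dual_sphere R s Y = sphere dual dnorm.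
Proof.
apply/seteqP; split=> f.
  by move=> [fl fc f1]; split; [split|rewrite /dnorm f1].
by move=> [[fl fc] f1]; split=> //; rewrite dual_normE// f1.
Qed.

Lemma dual_real_normed : real_normed dual dnorm.
Proof.
have dualP r f g : dual f -> dual g -> dual (r%:K *: f + g).
  move=> fd gd; apply: (@bounded_dual _ (`|r| * dnorm f + dnorm g)).
    move=> a u v; rewrite !fctE fd.1 gd.1 !scalerDr !scalerA mulrC.
    by rewrite -!addrA; congr (_ + _); rewrite addrCA.
  move=> y; rewrite !fctE (le_trans (rnormD _ _))// mulrDl lerD//; last exact: dnormP.
  by rewrite rnormZ rnorm_of_real -mulrA ler_wpM2l//; exact: dnormP.
have dual0 : dual 0.
  apply: (@bounded_dual _ 0); first by move=> a u v; rewrite /= scaler0 addr0.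
  by move=> y; rewrite mul0r /= /rnorm normr0 raddf0.
split=> //.
- move=> f g fd gd; apply: dnorm_ub; first by rewrite addr_ge0// dnorm_ge0.
  move=> y; rewrite fctE (le_trans (rnormD _ _))// mulrDl lerD//; exact: dnormP.
- have le r f : dual f -> dnorm (r%:K *: f) <= `|r| * dnorm f.
    move=> fd; apply: dnorm_ub; first by rewrite mulr_ge0// dnorm_ge0.
    by move=> y; rewrite fctE rnormZ rnorm_of_real -mulrA ler_wpM2l//; exact: dnormP.
  move=> r f fd; apply/eqP; rewrite eq_le le//=.
  have [->|r0] := eqVneq r 0.
    rewrite normr0 mul0r dnorm_ge0//.
    by have := dualP 0 f 0 fd dual0; rewrite addr0.
  (* The reverse inequality is [le] for the inverse scalar, applied to [r f]. *)
  rewrite -ler_pdivlMl ?normr_gt0// -normfV.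
  have := le r^-1 (r%:K *: f).
  rewrite scalerA -rmorphM mulVf// rmorph1 scale1r; apply.
  by have := dualP r f 0 fd dual0; rewrite addr0.
- move=> f fd f0; apply/funext => y; apply: rnorm0_eq0.
  by apply/eqP; rewrite eq_le rnorm_ge0 andbT; have := dnormP y fd; rewrite f0 mul0r.
Qed.

(** The limit is taken pointwise, at a rate proportional to [rnorm y]. Linearity passes to the
    limit, and the rate bounds the distance to each [u m], hence also the limit itself. *)
Lemma dual_real_complete : real_complete dual dnorm.
Proof.
move=> u C ud uC; have DN := dual_real_normed.
have C0 : 0 <= C.
  have := uC 0%N 0%N isT; rewrite expr0 mul1r; apply: le_trans.
  by apply: dnorm_ge0; exact: (domainB DN).
have q0 m : 0 <= 32^-1 ^+ m :> R by rewrite exprn_ge0// invr_ge0.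
have /choice[f fu] y : exists x : K^o, forall m,
    rnorm (x - u m y) <= 32^-1 ^+ m * (2 * (C * rnorm y)).
  apply: (@scalar_geometric_limit R s (fun n => u n y)) => m n mn.
  rewrite mulrA (le_trans (dnormP y (domainB DN (ud n) (ud m))))//.
  by rewrite ler_wpM2r ?rnorm_ge0// uC.
have fl : linear f.
  move=> a x y; apply/eqP; rewrite -subr_eq0; apply/eqP/rnorm0_eq0/eqP.
  rewrite eq_le rnorm_ge0 andbT.
  apply: (@geometric_le0 _ 32^-1 _ (2 * (C * rnorm (a *: x + y)) +
    (rnorm (a : K^o) * (2 * (C * rnorm x)) + 2 * (C * rnorm y)))).
    by apply/andP; split; lra.
  move=> m.
  have -> : f (a *: x + y) - (a *: f x + f y) =
      (f (a *: x + y) - u m (a *: x + y)) - (a *: (f x - u m x) + (f y - u m y)).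
    by rewrite (ud m).1 scalerBr [X in _ = _ - X]addrACA -opprD opprB addrA subrK.
  rewrite (le_trans (ler_normB_trans (rnorm_real_normed _) I I I (y := 0)))//.
  rewrite subr0 sub0r (normNx (rnorm_real_normed _) I) !mulrDr lerD//.
  rewrite (le_trans (rnormD _ _))// lerD//.
  by rewrite rnormZ mulrCA ler_wpM2l ?rnorm_ge0.
have fuD m y : rnorm ((f - u m) y) <= (32^-1 ^+ m * (2 * C)) * rnorm y.
  by rewrite (le_trans (fu y m))// -!mulrA.
have fd : dual f.
  apply: (@bounded_dual _ (32^-1 ^+ 0 * (2 * C) + dnorm (u 0%N))) => // y.
  rewrite -[f y](subrK (u 0%N y)) (le_trans (rnormD _ _))// mulrDl lerD//.
    exact: fuD.
  exact: dnormP.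
exists f; split=> // m; apply: dnorm_ub => //.
by rewrite mulr_ge0// mulr_ge0.
Qed.

End theory.
End dual.

(** Invert [g] on the image of [B] and use [t] elsewhere; the last clause allows the displacement to
    be estimated in either case. *)
Lemma surjection_of_injection {T U : Type} (A : set T) (B : set U)
    (g : U -> T) (t : T -> U) :
  set_fun B A g -> set_inj B g -> set_fun A B t ->
  exists h : T -> U, [/\ set_fun A B h, set_surj A B h &
    forall a, A a -> h a = t a \/ (B (h a) /\ g (h a) = a)].
Proof.
move=> gBA gI tAB.
have /choice[h hP] a : exists b,
    (B b /\ g b = a) \/ (b = t a /\ ~ exists2 b, B b & g b = a).
  have [[b Bb gb]|nb] := pselect (exists2 b, B b & g b = a).
    by exists b; left.
  by exists (t a); right.
exists h; split.
- by move=> a Aa; have [[]|[->]] := hP a => // _; exact: tAB.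
- move=> b Bb; exists (g b); first exact: gBA.
  have [[Bh /gI]|[_ []]] := hP (g b); last by exists b.
  by apply; exact/mem_set.
- by move=> a Aa; have [|[]] := hP a; [right|left].
Qed.

(** * The bound on k for a small opening *)

Section proposition.
Context {R : realType} {s : scalars}.
Local Notation K := (scalar_field R s).
Local Notation re := (@scalar_re R s).
Local Notation "r %:K" := (of_real s r) (at level 2, format "r %:K").

Lemma k_le (Y Z : normedModType K) (T : Y -> Z) (D : (Y -> K^o) -> (Z -> K^o)) c :
  set_fun (unit_sphere [set: Y]) (unit_sphere [set: Z]) T ->
  set_surj (unit_sphere [set: Y]) (unit_sphere [set: Z]) T ->
  set_fun (@dual_sphere R s Y) (@dual_sphere R s Z) D ->
  set_surj (@dual_sphere R s Y) (@dual_sphere R s Z) D ->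
  (k_gap T D <= c)%E -> (k Y Z <= c)%E.
Proof.
move=> Tf Ts Df Ds gap.
have [T' ET] := Pfun Tf; subst T; have [T ET] := funPsurj Ts; subst T'.
have [D' ED] := Pfun Df; subst D; have [D ED] := funPsurj Ds; subst D'.
have kv : k_values Y Z (k_gap T D) by exists T, D.
rewrite /k; case: eqP => [k0|_]; first by move: kv; rewrite k0.
exact: (le_trans (ereal_inf_lbound kv)).
Qed.

Lemma sphere_unit (Y : normedModType K) (y : Y) :
  unit_sphere [set: Y] y <-> rnorm y = 1.
Proof.
by split=> [[_ /rnorm_eq1]|/rnorm_eq1].
Qed.

(** Each gap compares two scalars of absolute value at most 1. This bound is what disposes of
    openings of 1/10 or more. *)
Lemma k_le2 (Y Z : normedModType K) : (k Y Z <= 2%:E)%E.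
Proof.
rewrite /k; case: eqP => [_|/eqP/set0P[_ [T [D _]]]]; first exact: lexx.
have kv : k_values Y Z (k_gap T D) by exists T, D.
apply: (le_trans (ereal_inf_lbound kv)); apply: ge_ereal_sup.
move=> _ [y Sy [f Sf <-]]; rewrite enormE lee_fin.
have /sphere_unit Ty : unit_sphere [set: Z] (T y) by exact: funS.
have SE (W : normedModType K) g : @dual_sphere R s W g -> sphere dual dnorm g.
  by rewrite dual_sphereE.
have [Dd D1] : sphere dual dnorm (D f) by apply: SE; exact: funS.
have [fd f1] := SE _ _ Sf.
rewrite (le_trans (ler_normBx (rnorm_real_normed _) I I))//.
have := dnormP y fd; have := dnormP (T y) Dd.
by rewrite D1 f1 Ty (proj1 (sphere_unit y) Sy); lra.
Qed.

Lemma dnorm_ub_sphere (Y : normedModType K) (f : Y -> K^o) C : 0 <= C ->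
  linear f -> (forall y, rnorm y = 1 -> rnorm (f y) <= C) -> dnorm f <= C.
Proof.
move=> C0 fl fC; apply: dnorm_ub => // y.
have [->|/eqP y0] := eqVneq y 0.
  by rewrite (linear_fun0 fl) /rnorm !normr0 !raddf0 mulr0.
have YN := rnorm_real_normed Y.
have := norm_gt0x YN (I : setT y) y0 => y1.
have [_ Sy] := sphere_normalize YN (I : setT y) y1.
have := fC _ Sy.
rewrite (linear_funZ fl) rnormZ rnorm_of_real ger0_norm ?invr_ge0 ?rnorm_ge0//.
by rewrite ler_pdivrMl// mulrC.
Qed.

Lemma rnormBC (Y : normedModType K) (x y : Y) : rnorm (x - y) = rnorm (y - x).
Proof. exact: (normBC (rnorm_real_normed Y)). Qed.

Lemma ler_rnormB_trans (Y : normedModType K) (y x z : Y) :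
  rnorm (x - z) <= rnorm (x - y) + rnorm (y - z).
Proof. exact: (ler_normB_trans (rnorm_real_normed Y)). Qed.

(** Extend [h] from [V Z] to [X], restrict to [U Y] and normalize. The restriction has norm at most
    1, and at least [1 - w] because each unit vector of [V Z] is within [w] of one of [U Y]; so
    normalizing costs at most [w]. *)
Lemma dual_transfer (X Y Z : normedModType K) (U : {linear Y -> X})
    (V : {linear Z -> X}) (w : R) (h : Z -> K^o) :
  isometric U -> isometric V -> 0 < w < 1 ->
  (forall z, rnorm z = 1 -> exists2 y, rnorm y = 1 & rnorm (U y - V z) <= w) ->
  sphere dual dnorm h ->
  exists2 f : Y -> K^o, sphere dual dnorm f &
    forall y z, rnorm y = 1 -> rnorm z = 1 ->
      rnorm (f y - h z) <= rnorm (U y - V z) + w.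
Proof.
move=> Uiso Viso /andP[w0 w1] VU [hd h1].
have UN y : rnorm (U y) = rnorm y by rewrite /rnorm Uiso.
have VN z : rnorm (V z) = rnorm z by rewrite /rnorm Viso.
have [|z|F [Fl FN Fh]] := @hahn_banach R s X Z V h; first exact: hd.1.
  by rewrite VN (le_trans (dnormP z hd))// h1 mul1r.
pose f1 : Y -> K^o := fun y => F (U y).
have f1l : linear f1 by move=> a x y; rewrite /f1 linearP Fl.
have f1N y : rnorm (f1 y) <= 1 * rnorm y by rewrite mul1r -UN; exact: FN.
have f1d : dual f1 by exact: bounded_dual f1l f1N.
have f1_le1 : dnorm f1 <= 1 by exact: dnorm_ub.
have f1h y z : rnorm (f1 y - h z) <= rnorm (U y - V z).
  by rewrite /f1 -Fh -(linear_funB Fl); exact: FN.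
have f1_ge : 1 - w <= dnorm f1.
  rewrite lerBlDr -h1; apply: dnorm_ub_sphere; last 2 first.
  - exact: hd.1.
  - move=> z /VU[y y1 yz].
    have := rnormD (f1 y) (h z - f1 y); rewrite addrC subrK rnormBC.
    by have := f1h y z; have := dnormP y f1d; rewrite y1; lra.
  by rewrite addr_ge0 ?dnorm_ge0// ltW.
have f1_gt0 : 0 < dnorm f1 by lra.
have DN := @dual_real_normed R s Y.
exists ((dnorm f1)^-1%:K *: f1); first exact: (sphere_normalize DN).
move=> y z y1 z1; rewrite (le_trans (ler_rnormB_trans (f1 y) _ _))//.
rewrite addrC lerD// fctE.
have -> : (dnorm f1)^-1%:K *: f1 y - f1 y = ((dnorm f1)^-1 - 1)%:K *: f1 y.
  by rewrite rmorphB rmorph1 scalerBl scale1r.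
rewrite rnormZ rnorm_of_real ger0_norm; last by rewrite subr_ge0 invf_ge1.
rewrite (@le_trans _ _ (((dnorm f1)^-1 - 1) * dnorm f1))//.
  by rewrite ler_wpM2l ?subr_ge0 ?invf_ge1//; have := dnormP y f1d; rewrite y1 mulr1.
by rewrite mulrBl mulVf ?gt_eqF//; lra.
Qed.

Lemma k_le_opening (X : normedModType K) (Y Z : completeNormedModType K)
    (U : {linear Y -> X}) (V : {linear Z -> X}) (w : R) :
  isometric U -> isometric V -> 0 < w < 10^-1 ->
  (exists e : Y, rnorm e = 1) ->
  (forall y, rnorm y = 1 -> exists2 z, rnorm z = 1 & rnorm (U y - V z) <= w) ->
  (forall z, rnorm z = 1 -> exists2 y, rnorm y = 1 & rnorm (U y - V z) <= w) ->
  (k Y Z <= (20 * w)%:E)%E.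
Proof.
move=> Uiso Viso /andP[w0 w1] [e e1] UV VU.
have UN y : rnorm (U y) = rnorm y by rewrite /rnorm Uiso.
have VN z : rnorm (V z) = rnorm z by rewrite /rnorm Viso.
have UB y y' : rnorm (U y - U y') = rnorm (y - y') by rewrite -linearB UN.
have VB y y' : rnorm (V y - V y') = rnorm (y - y') by rewrite -linearB VN.
have YN := rnorm_real_normed Y; have ZN := rnorm_real_normed Z.
have Ycomp := @rnorm_real_complete R s Y.
have [F [Fl FN Fe]] := norming_real_functional e1.
have /choice[phi phiP] z : exists y, rnorm z = 1 ->
    rnorm y = 1 /\ rnorm (U y - V z) <= w.
  by have [/VU[y]|nz] := pselect (rnorm z = 1); [exists y|exists 0].
have /choice[tau tauP] y : exists z, rnorm y = 1 ->
    rnorm z = 1 /\ rnorm (U y - V z) <= w.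
  by have [/UV[z]|nz] := pselect (rnorm y = 1); [exists z|exists 0].
have [T [TS Tsurj TP]] : exists T : Y -> Z,
    [/\ set_fun (unit_sphere [set: Y]) (unit_sphere [set: Z]) T,
        set_surj (unit_sphere [set: Y]) (unit_sphere [set: Z]) T &
      forall y, rnorm y = 1 -> rnorm (U y - V (T y)) <= 5 * w].
  (* Unit vectors more than [3 w] apart have images under [phi] at least [3 w - 2 w] apart, so
     [delta = 3 w] and [rho = w]. The closeness [eta] is chosen to be [w]. *)
  have [|||||g [gS gI gP]] := @sphere_injection R s Y Z setT (@rnorm R s Y) setT
      (@rnorm R s Z) F e YN ZN Ycomp Fl (fun x _ => FN x) I Fe phi (3 * w) w w.
  - by move=> z [_ z1]; split=> //; exact: (phiP z z1).1.
  - by apply/andP; split; lra.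
  - by [].
  - move=> z z' [_ z1] [_ z1'] zz'.
    have [_ h1] := phiP _ z1; have [_ h2] := phiP _ z1'.
    have := ler_rnormB_trans (U (phi z)) (V z) (V z').
    have := ler_rnormB_trans (U (phi z')) (U (phi z)) (V z').
    by rewrite UB VB (rnormBC (V z)); lra.
  - by [].
  have sphereE (W : normedModType K) :
      sphere [set: W] (@rnorm R s W) = unit_sphere [set: W].
    by apply/seteqP; split=> x [_ /rnorm_eq1].
  rewrite !sphereE in gS gI gP.
  have [|T [TS Tsurj TP]] := surjection_of_injection (t := tau) gS gI.
    by move=> y /sphere_unit/tauP[z1 _]; exact/sphere_unit.
  exists T; split=> // y y1.
  have [->|[STy gTy]] := TP y (proj2 (sphere_unit y) y1).
    by have [_] := tauP y y1; lra.
  (* The path from [U y] through [U (phi z')] and [V z'] to [V (T y)] has length at most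
     [w + w + 3 w]. *)
  have [z' [/sphere_unit z1' Tz']] := gP _ STy; rewrite gTy => yz'.
  have [_ h1] := phiP _ z1'.
  have := ler_rnormB_trans (U (phi z')) (U y) (V (T y)).
  have := ler_rnormB_trans (V z') (U (phi z')) (V (T y)).
  by rewrite UB VB (rnormBC z'); lra.
have DYN := @dual_real_normed R s Y; have DZN := @dual_real_normed R s Z.
have DYcomp := @dual_real_complete R s Y.
have /choice[psi psiP] h : exists f : Y -> K^o, sphere dual dnorm h ->
    sphere dual dnorm f /\ forall y z, rnorm y = 1 -> rnorm z = 1 ->
      rnorm (f y - h z) <= rnorm (U y - V z) + w.
  have [Sh|nh] := pselect (sphere dual dnorm h); last by exists 0.
  have [|f Sf fh] := dual_transfer Uiso Viso _ VU Sh (w := w).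
    by apply/andP; split; lra.
  by exists f.
have /choice[sigma sigmaP] f : exists h : Z -> K^o, sphere dual dnorm f ->
    sphere dual dnorm h /\ forall y z, rnorm y = 1 -> rnorm z = 1 ->
      rnorm (f y - h z) <= rnorm (U y - V z) + w.
  have [Sf|nf] := pselect (sphere dual dnorm f); last by exists 0.
  have [||h Sh hf] := dual_transfer Viso Uiso _ _ Sf (w := w).
  - by apply/andP; split; lra.
  - by move=> y /UV[z z1 yz]; exists z => //; rewrite rnormBC.
  by exists h => // _; split=> // y z y1 z1; rewrite rnormBC (rnormBC (U y)) hf.
(* On the dual, the real part of evaluation at [e] takes the role of [F]; the complexification of
   [F] is a functional where it equals 1. *)
pose ev (f : Y -> K^o) : R := re (f e).
have evl : real_linear ev by move=> r f g; rewrite /ev raddfD /= scalar_reM.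
have evN f : dual f -> `|ev f| <= dnorm f.
  move=> fd; rewrite (le_trans (ler_abs_re _))//.
  by have := dnormP e fd; rewrite e1 mulr1.
have [f0 f0d f0e] : exists2 f, dual f & ev f = 1.
  have [|f [fl fF fN]] := real_linear_scalar_re Fl.
    by move=> x; rewrite (le_trans (ler_norm _)).
  exists f; last by rewrite /ev fF.
  by apply: (@bounded_dual _ _ _ _ 1) => // y; rewrite mul1r.
(* At unit vectors within [w] of each other, [h] and [psi h] differ by at most [2 w]. Functionals
   more than [5 w] apart thus have images at least [w] apart. The condition [5 w < 1/2] is where
   [w < 1/10] enters. *)
have [|||||g [gS gI gP]] := @sphere_injection R s (Y -> K^o) (Z -> K^o) dual dnorm
    dual dnorm ev f0 DYN DZN DYcomp evl evN f0d f0e psi (5 * w) w w.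
- by move=> h /psiP[].
- by apply/andP; split; lra.
- by [].
- move=> h h' Sh Sh' hh'; rewrite leNgt; apply/negP => lt_w.
  have [Sf fh] := psiP _ Sh; have [Sf' fh'] := psiP _ Sh'.
  move: hh'; apply/negP; rewrite -leNgt; apply: dnorm_ub_sphere; first by lra.
    exact: (domainB DZN Sh.1 Sh'.1).1.
  move=> z z1; have [y y1 yz] := VU z z1.
  have := dnormP y (domainB DYN Sf.1 Sf'.1); rewrite y1 mulr1 !fctE.
  have := fh y z y1 z1; have := fh' y z y1 z1.
  have := ler_rnormB_trans (psi h y) (h z) (h' z).
  have := ler_rnormB_trans (psi h' y) (psi h y) (h' z).
  by rewrite (rnormBC (h z) (psi h y)); lra.
- by [].
rewrite -!dual_sphereE in gS gI.
have [|D [DS Dsurj DP]] := surjection_of_injection (t := sigma) gS gI.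
  by rewrite !dual_sphereE => f /sigmaP[].
apply: (k_le TS Tsurj DS Dsurj); apply: ge_ereal_sup.
move=> _ [y /sphere_unit y1 [f Sf <-]]; rewrite enormE lee_fin.
have Ty1 : rnorm (T y) = 1 by exact/sphere_unit/TS/sphere_unit.
have := TP y y1.
have Sf' := Sf; rewrite dual_sphereE in Sf'.
have [->|[SDf gDf]] := DP f Sf.
  (* The loss is [5 w] from [T] and [w] from the transfer of functionals. *)
  by have [_ /(_ y (T y) y1 Ty1)] := sigmaP _ Sf'; lra.
rewrite dual_sphereE in SDf.
(* From [f y] through [psi h' y] and [h' (T y)] to [D f (T y)] the losses are [w], [6 w] and
   [5 w]. *)
have [h' [Sh' Dh']] := gP _ SDf; rewrite gDf => fh'.
have [Sp /(_ y (T y) y1 Ty1)] := psiP _ Sh'.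
have := dnormP y (domainB DYN Sf'.1 Sp.1); rewrite y1 mulr1 !fctE.
have := dnormP (T y) (domainB DZN SDf.1 Sh'.1); rewrite Ty1 mulr1 !fctE.
have := ler_rnormB_trans (psi h' y) (f y) (D f (T y)).
have := ler_rnormB_trans (h' (T y)) (psi h' y) (D f (T y)).
by rewrite (rnormBC (h' (T y))); lra.
Qed.

End proposition.

(** * Openings and degenerate spaces *)

Section opening.
Context {R : realType} {s : scalars}.
Local Notation K := (scalar_field R s).
Local Open Scope ereal_scope.

Lemma Omega0_lt (X : normedModType K) (A B : set X) (w : R) :
  Omega0 A B < w%:E -> forall a, unit_sphere A a ->
  exists2 b, unit_sphere B b & (rnorm (a - b) <= w)%R.
Proof.
move=> AB a Sa.
have : dist a (unit_sphere B) < w%:E.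
  by apply: le_lt_trans AB; apply: ereal_sup_ubound; exists a.
move=> /ereal_inf_lt[_ [b Sb <-]]; rewrite enormE lte_fin => /ltW ab.
by exists b.
Qed.

Lemma Omega0_ge0 (X : normedModType K) (A B : set X) a :
  unit_sphere A a -> 0 <= Omega0 A B.
Proof.
move=> Sa; apply: (@le_trans _ _ (dist a (unit_sphere B))).
  by apply: le_ereal_inf_tmp => _ [b _ <-]; rewrite enormE lee_fin rnorm_ge0.
by apply: ereal_sup_ubound; exists a.
Qed.

Lemma Omega0_pinfty (X : normedModType K) (A B : set X) a :
  unit_sphere A a -> unit_sphere B = set0 -> Omega0 A B = +oo.
Proof.
move=> Sa B0; apply/eqP; rewrite -leye_eq.
have -> : +oo = dist a (unit_sphere B) by rewrite /dist B0 image_set0 ereal_inf0.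
by apply: ereal_sup_ubound; exists a.
Qed.

Lemma unit_sphere_range (X Y : normedModType K) (U : {linear Y -> X}) :
  isometric U -> forall y, rnorm y = 1%R -> unit_sphere (range U) (U y).
Proof. by move=> Uiso y /rnorm_eq1 y1; split; [exists y|rewrite Uiso]. Qed.

Lemma Omega0_range_lt (X Y Z : normedModType K) (U : {linear Y -> X})
    (V : {linear Z -> X}) (w : R) : isometric U -> isometric V ->
  Omega0 (range U) (range V) < w%:E ->
  forall y, rnorm y = 1%R -> exists2 z, rnorm z = 1%R & (rnorm (U y - V z) <= w)%R.
Proof.
move=> Uiso Viso UV y /(unit_sphere_range Uiso) /(Omega0_lt UV)[_ [[z _ <-]]].
by rewrite Viso => /rnorm_eq1 z1 yz; exists z.
Qed.

(** The unit spheres and the dual spheres are all empty, so any two maps are surjections between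
    them, and the gap is a supremum over the empty set. *)
Lemma k_trivial (Y Z : normedModType K) :
  (forall y : Y, rnorm y <> 1%R) -> (forall z : Z, rnorm z <> 1%R) ->
  k Y Z = -oo.
Proof.
move=> Y0 Z0; apply/eqP; rewrite -leeNy_eq.
have dual0 (W : normedModType K) : (forall x : W, rnorm x <> 1%R) ->
    forall f, ~ @dual_sphere R s W f.
  move=> W0 f; rewrite dual_sphereE => -[[fl _] f1].
  have := @dnorm_ub_sphere R s W f 0%R (lexx _) fl (fun y y1 => False_ind _ (W0 y y1)).
  by rewrite f1 ler10.
apply: (@k_le _ _ _ _ (fun=> 0%R) (fun=> 0%R)).
- by move=> y /sphere_unit /Y0.
- by move=> z /sphere_unit /Z0.
- by move=> f /(dual0 _ Y0).
- by move=> f /(dual0 _ Z0).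
- apply: ge_ereal_sup => x [y Sy _]; case: (Y0 y); exact/sphere_unit.
Qed.

Lemma k_le_Omega (X : normedModType K) (Y Z : completeNormedModType K)
    (U : {linear Y -> X}) (V : {linear Z -> X}) :
  isometric U -> isometric V -> k Y Z <= 20%:E * Omega (range U) (range V).
Proof.
move=> Uiso Viso.
have range0 (W : normedModType K) (L : {linear W -> X}) : isometric L ->
    (forall x : W, rnorm x <> 1%R) -> unit_sphere (range L) = set0.
  move=> Liso W0; apply/seteqP; split=> // _ [[x _ <-]].
  by rewrite Liso => /rnorm_eq1 /W0.
(* If only [Y] lacks unit vectors, the distance to its empty sphere makes the opening infinite; if
   both spaces lack them, [k] is [-oo]. *)
have [[e e1]|/forallNP Y0] := pselect (exists y : Y, rnorm y = 1%R); last first.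
  have [[e e1]|/forallNP Z0] := pselect (exists z : Z, rnorm z = 1%R).
    rewrite /Omega (Omega0_pinfty (unit_sphere_range Viso e1) (range0 _ _ Uiso Y0)).
    by rewrite maxey gt0_muley ?leey.
  by rewrite k_trivial// leNye.
have O0 : 0 <= Omega (range U) (range V).
  by rewrite /Omega le_max (Omega0_ge0 _ (unit_sphere_range Uiso e1)).
case O_E : (Omega (range U) (range V)) O0 => [r||] //; last first.
  by move=> _; rewrite gt0_muley ?leey.
rewrite lee_fin => r0; rewrite leNgt -EFinM; apply/negP => ko.
have : exists kr : R, k Y Z = kr%:E.
  have := k_le2 Y Z; move: ko; case: (k Y Z) => // kr _ _; by exists kr.
move=> [kr kE]; move: ko; rewrite kE lte_fin => ko.
have := k_le2 Y Z; rewrite kE lee_fin => k2.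
(* The midpoint of [r] and [kr / 20] exceeds the opening, contradicts [kr <= 20 w], and is below
   1/10 because [kr <= 2]. *)
pose w := ((r + kr / 20) / 2)%R.
have rw : (r < w)%R by rewrite /w; lra.
have Ow : maxe (Omega0 (range U) (range V)) (Omega0 (range V) (range U)) < w%:E.
  by move: O_E; rewrite /Omega => ->; rewrite lte_fin.
move: Ow; rewrite gt_max => /andP[UV VU].
have := @k_le_opening R s X Y Z U V w Uiso Viso.
rewrite kE lee_fin => /(_ _ (ex_intro _ e e1) (Omega0_range_lt Uiso Viso UV)) h.
have : (kr <= 20 * w)%R.
  apply: h; first by apply/andP; split; rewrite /w; lra.
  move=> z z1; have [y y1 yz] := Omega0_range_lt Viso Uiso VU z1.
  by exists y => //; rewrite rnormBC.
by rewrite /w; lra.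
Qed.

End opening.

Local Open Scope ereal_scope.

Theorem proposition1 (R : realType) (s : scalars)
    (Y Z : completeNormedModType (scalar_field R s)) :
  20%:E * d_Omega Y Z >= k Y Z.
Proof.
rewrite -lee_pdivrMl ?ltr0n//; apply: le_ereal_inf_tmp.
move=> _ [X [U [V [Uiso Viso ->]]]].
by rewrite lee_pdivrMl ?ltr0n//; exact: k_le_Omega.
Qed.
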